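(* Let $(\Omega,d,\mu)$ be a metric measure space such that $\mu$ is $c$-almost continuous and $\alpha$-lower bounded (with $\mu(B(x,r))\ge r^\alpha$ for all $x\in\Omega$, $r>0$). Let $s>0$ and $1\le p\le\infty$ (with $1/p=0$ if $p=\infty$). Then there is a constant $C>0$, independent of $f$ and $g$, such that for every $f\in M^{s,p}(\Omega)$ and every $g\in D^{s}(f)$ the following hold. 1. Suppose $s/\alpha<1$. (a) If $s/\alpha<\frac1p$, then $$\|f\|_{L^{p^{*},p}}\le C\,\|g\|_{L^{p}},\qquad\text{where } p^{*}=\frac{\alpha p}{\alpha-sp}.$$ (b) If $\frac1p=s/\alpha$, then $$\left(\int_{0}^{1}\left(\frac{f^{**}(t)}{1+\ln\left(\frac1t\right)}\right)^{p}\frac{dt}{t}\right)^{1/p}\le C\big(\|g\|_{L^{p}}+\|f\|_{L^{1}+L^{\infty}}\big).$$ (c) If $\frac1p<s/\alpha$, then $$\|f\|_{L^{\infty}}\le C\big(\|g\|_{L^{p}}+\|f\|_{L^{1}+L^{\infty}}\big).$$ 2. If $s/\alpha=1$, then $$\sup_{t>0}t^{1/p}\,\frac{f^{**}(t)-f^{*}(t)}{t}\le C\,\|g\|_{L^{p}}.$$ In particular, if $p=1$, then $\|f\|_{L^{\infty}_{w}}\le C\,\|f\|_{M^{s,1}(\Omega)}$. 3. If $s/\alpha>1$, then $$\|f\|_{L^{\infty}}\le C\big(\|g\|_{L^{p}}+\|f\|_{L^{1}+L^{\infty}}\big).$$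
   Context: A metric measure space $(\Omega,d,\mu)$ is a metric space $(\Omega,d)$ with a Borel measure $\mu$ such that $0<\mu(B)<\infty$ for every ball $B(x,r)=\{y\in\Omega: d(x,y)<r\}$; it is always assumed that $\mu(\Omega)=\infty$ and $\mu(\{x\})=0$ for all $x\in\Omega$. $\mu$ is $\alpha$-lower bounded if there are $b,\alpha>0$ with $\mu(B(x,r))\ge b r^{\alpha}$ for all $x\in\Omega$, $r>0$; for simplicity one takes $b=1$. $\mu$ is $c$-almost continuous ($c\ge1$) if for every $t>0$ and every $x\in\Omega$ there is $r(x)>0$ such that $t\le\mu(B(x,r(x)))\le c\,t$ (this holds, for instance, if $r\mapsto\mu(B(x,r))$ is continuous for every $x$, or if $\mu$ is doubling). For measurable $f:\Omega\to\mathbb{R}$, $\mu_f(\lambda)=\mu\{x:|f(x)|>\lambda\}$, the decreasing rearrangement is $f^{*}(t)=\inf\{\lambda\ge0:\mu_f(\lambda)\le t\}$, and $f^{**}(t)=\frac1t\int_0^t f^{*}(z)\,dz$ for $t>0$. The Lorentz norm is $\|f\|_{L^{q,p}}=\left(\int_0^\infty (t^{1/q}f^{**}(t))^{p}\frac{dt}{t}\right)^{1/p}$; thus $\|f\|_{L^{p^{*},p}}=\|t^{-s/\alpha}f^{**}(t)\|_{L^p(0,\infty)}$ for $p^{*}=\alpha p/(\alpha-sp)$. The weak $L^\infty$ quantity is $\|f\|_{L^{\infty}_{w}}=\sup_{t>0}(f^{**}(t)-f^{*}(t))$. For $s>0$, $f\in M^{s,p}(\Omega)$ means that $f\in L^{p}(\Omega)$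 and there is a non-negative measurable $g\in L^{p}(\Omega)$ with $$|f(x)-f(y)|\le d(x,y)^{s}(g(x)+g(y))\quad \mu\text{-a.e. }x,y\in\Omega.$$ Such a $g$ is called an $s$-gradient of $f$, and $D^{s}(f)$ denotes the collection of all $s$-gradients of $f$. The norm is $\|f\|_{M^{s,p}(\Omega)}=\|f\|_{L^{p}}+\inf_{g\in D^{s}(f)}\|g\|_{L^{p}}$. *)

(* Defs.v *)
From HB Require Import structures.
From mathcomp Require Import all_boot all_order all_algebra.
From mathcomp Require Import all_classical all_reals all_analysis.

Set Implicit Arguments.
Unset Strict Implicit.
Unset Printing Implicit Defensive.
Import Order.TTheory GRing.Theory Num.Theory.
Import numFieldNormedType.Exports.
Local Open Scope classical_set_scope.
Local Open Scope ring_scope.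

(* The join imposes no compatibility between the metric and the sigma-algebra;
   that the latter is the Borel one is part of [metric_measure_space]. *)
#[short(type="metricMeasurableType")]
HB.structure Definition MetricMeasurable (K : numDomainType) d :=
  { T of Metric K T & Measurable d T }.

Section MetricMeasure.
Context {R : realType} {d : measure_display} {T : metricMeasurableType R d}.
Variable mu : {measure set T -> \bar R}.
Local Open Scope ereal_scope.

Definition metric_measure_space : Prop :=
  [/\ (measurable : set (set T)) = <<s (@open T) >>,
      forall (x : T) (r : R), (0 < r)%R -> 0 < mu (ball x r) < +oo,
      mu [set: T] = +oo
    & forall x : T, mu [set x] = 0].

Definition lower_bounded (alpha : R) : Prop :=
  forall (x : T) (r : R), (0 < r)%R -> (r `^ alpha)%:E <= mu (ball x r).

Definition almost_continuous (c : R) : Prop :=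
  forall (t : R) (x : T), (0 < t)%R ->
    exists2 r : R, (0 < r)%R & t%:E <= mu (ball x r) <= (c * t)%:E.

(* As usual for Hajlasz gradients, "a.e. x, y" means: for all x and y outside
   a single null set. *)
Definition sgradient (s : R) (p : \bar R) (f : T -> R) : set (T -> R) :=
  [set g | [/\ g \in Lfun mu p,
              forall x, (0 <= g x)%R
            & exists2 E : set T, mu.-negligible E &
              forall x y, ~ E x -> ~ E y ->
                (`|f x - f y| <= mdist x y `^ s * (g x + g y))%R]].

Definition hajlasz_sobolev (s : R) (p : \bar R) : set (T -> R) :=
  [set f | f \in Lfun mu p /\ sgradient s p f !=set0].

Definition hajlasz_norm (s : R) (p : \bar R) (f : T -> R) : \bar R :=
  'N[mu]_p[EFin \o f] +
  ereal_inf [set 'N[mu]_p[EFin \o g] | g in sgradient s p f].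

End MetricMeasure.

Section Rearrangement.
Context {R : realType} {d : measure_display} {T : measurableType d}.
Variable mu : {measure set T -> \bar R}.
Local Open Scope ereal_scope.

Definition distribution_fun (f : T -> R) (l : R) : \bar R :=
  mu [set x | (l < `|f x|)%R].

Definition rearrangement (f : T -> R) (t : R) : \bar R :=
  ereal_inf [set l%:E | l in
    [set l : R | (0 <= l)%R /\ distribution_fun f l <= t%:E]].

Definition max_rearrangement (f : T -> R) (t : R) : \bar R :=
  (t^-1)%:E * \int[lebesgue_measure]_(z in `]0%R, t[) rearrangement f z.

Definition lorentz_norm (q p : R) (f : T -> R) : \bar R :=
  (\int[lebesgue_measure]_(t in `]0%R, +oo[)
     (((t `^ q^-1)%:E * max_rearrangement f t) `^ p * (t^-1)%:E)) `^ p^-1.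

Definition weak_Linfty (f : T -> R) : \bar R :=
  ereal_sup [set max_rearrangement f t - rearrangement f t | t in `]0%R, +oo[].

Definition sum_L1_Linfty_norm (f : T -> R) : \bar R :=
  ereal_inf [set 'N[mu]_1[EFin \o h.1] + 'N[mu]_+oo[EFin \o h.2] | h in
    [set h : (T -> R) * (T -> R) |
      [/\ h.1 \in Lfun mu 1, h.2 \in Lfun mu +oo
        & forall x, f x = (h.1 x + h.2 x)%R]]].

End Rearrangement.

(* Main.v *)
Require Import Defs.
From HB Require Import structures.
From mathcomp Require Import all_boot all_order all_algebra.
From mathcomp Require Import all_classical all_reals all_analysis.
From mathcomp Require Import measurable_realfun ess_sup_inf.
From mathcomp Require Import ring lra.

Set Implicit Arguments.
Unset Strict Implicit.
Unset Printing Implicit Defensive.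

Import Order.TTheory GRing.Theory Num.Theory.
Import numFieldNormedType.Exports.
Local Open Scope classical_set_scope.
Local Open Scope ring_scope.

(** Write [f^*] for the decreasing rearrangement, [f^**] for its running mean
and [sg = s / alpha].  Everything follows from one inequality between the
rearrangements of a function and of its gradient,

    f^*(z) <= f^*(t) + K t^sg (g^*(z) + g^*(t))        for all z, t > 0,

proved in [oscillation_estimate].  Given [x], almost continuity yields a ball
around [x] whose mass lies between [3 t] and [3 c t], and the lower bound on the
measure turns this into a bound [(3 c t)^(1/alpha)] on its radius.  The sets
[|f| > f^*(t)] and [g > g^*(t)] have mass at most [t] each, so the ball contains
a point [y] outside both, and comparing [f x] with [f y] through the gradient
gives a pointwise bound of [|f x|] by an increasing function of [g x].
Having [g^*] and not [g^**] on the right is what makes [p = 1] accessible: the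
operator [g^* -> g^**] is unbounded on [L^1].

Along the points [t_j = t_0 / 2^j], with [a_j = f^*(t_j)] and [b_j = g^*(t_j)],
the inequality becomes the recursion [a_(j+1) <= a_j + 2 K t_j^sg b_(j+1)], where
[sum_j t_j b_j^p] is controlled by [|g|_p^p] ([sum_rearr_powR_le_Lnorm], a summation by parts of
the layer-cake formula).  The cases differ in how the recursion is summed.
- If [sg < 1/p], multiplying by [t_j^(1/p - sg)] makes it a contraction up to an
  [l^p] error.  The initial term is [O(t_0^(-sg) |f|_p)], hence disappears as
  [t_0] tends to infinity.
- If [sg = 1/p], the error [t_j^(1/p) b_j] is in [l^p], and the discrete Hardy
  inequality ([hardy_discrete]) bounds [a_j / (j + 1)] in [l^p].
- If [sg > 1/p], the weak bound [t^(1/p) g^*(t) <= 4 |g|_p] makes the increments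
  geometric, so [f^*] is bounded at [0].  This covers the case [s > alpha] too.
- If [sg = 1], integrating the inequality in [z] over [(0, t)] gives a bound on
  [f^** - f^*], and [t^(1/p) g^**(t)] is bounded by a multiple of [|g|_p].

In the first two cases [f^*] must still be replaced by [f^**].  Since [f^*] is
nonincreasing, [f^**(2 t) <= (f^**(t) + f^*(t)) / 2], which contracts weighted
[l^p] norms as long as the weight grows by a factor less than 2 per dyadic step
([hardy_averages], [weighted_hardy]).  Where the [L^1 + L^oo] norm
occurs, it only serves to bound the starting value [f^*(1)]. *)

(** * Recursive inequalities for real sequences *)

Section RealSequences.
Context {R : realType}.
Implicit Types (p r x y z : R) (X Y Z : nat -> R).

Lemma dyadic_half (t : R) (j : nat) : t / 2 ^+ j.+1 = t / 2 ^+ j / 2.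
Proof. by rewrite exprS; field; rewrite expf_neq0. Qed.

Lemma powR_convex_comb p r x y : 1 <= p -> 0 < r < 1 -> 0 <= x -> 0 <= y ->
  (r * x + (1 - r) * y) `^ p <= r * x `^ p + (1 - r) * y `^ p.
Proof.
move=> p1 /andP[r0 r1] x0 y0.
have := @convex_powR R p p1 (Itv01 (ltW r0) (ltW r1)) x y.
by rewrite !convRE /= => -> //; rewrite inE /= in_itv/= andbT.
Qed.

(** Splitting [z] as the convex combination [r x + (1 - r) (y / (1 - r))] keeps
    the coefficient of [x `^ p] strictly below 1, so that a recursion contracting
    a sequence also contracts its [p]-th powers. *)
Lemma powR_absorb p r x y z : 1 <= p -> 0 < r < 1 -> 0 <= x -> 0 <= y ->
  0 <= z -> z <= r * x + y ->
  z `^ p <= r * x `^ p + (1 - r) `^ (1 - p) * y `^ p.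
Proof.
move=> p1 r01 x0 y0 z0 zxy; have /andP[r0 r1] := r01.
have r1' : 0 < 1 - r by rewrite subr_gt0.
have p0 : 0 <= p by rewrite (le_trans _ p1).
have zE : z <= r * x + (1 - r) * (y / (1 - r)).
  by rewrite mulrCA divff ?gt_eqF// mulr1.
apply: (le_trans (ge0_ler_powR p0 _ _ zE)) => //; rewrite ?nnegrE//.
  by rewrite addr_ge0// mulr_ge0// ?divr_ge0// ltW.
have yr0 : 0 <= y / (1 - r) by rewrite divr_ge0// ltW.
apply: (le_trans (powR_convex_comb p1 r01 x0 yr0)).
rewrite lerD2l powRM ?invr_ge0//; last exact: ltW.
rewrite -powR_inv1 ?(ltW r1')// -powRrM mulN1r.
rewrite mulrCA mulrC ler_wpM2r ?powR_ge0//.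
rewrite [leRHS]powRD; last by rewrite (gt_eqF r1') implybT.
by rewrite powRr1// ltW.
Qed.

Lemma sum_geometric_lt r n : 0 <= r < 1 -> \sum_(i < n) r ^+ i <= (1 - r)^-1.
Proof.
move=> /andP[r0 r1]; have r1' : 0 < 1 - r by rewrite subr_gt0.
rewrite -[leRHS]mul1r ler_pdivlMr//.
suff: (\sum_(i < n) r ^+ i) * (1 - r) + r ^+ n = 1.
  by move=> E; rewrite -[leRHS]E lerDl exprn_ge0.
elim: n => [|n IH]; first by rewrite big_ord0 mul0r add0r.
by rewrite big_ord_recr/= exprS -[RHS]IH; ring.
Qed.

Lemma sum_absorb_forward r X Y n :
  (forall j, X j.+1 <= r * X j + Y j.+1) ->
  (1 - r) * (\sum_(j < n) X j) + X n <= X 0 + \sum_(j < n) Y j.+1.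
Proof.
move=> XY; elim: n => [|n IH]; first by rewrite !big_ord0 mulr0 add0r addr0.
by rewrite !big_ord_recr/=; have := XY n; lra.
Qed.

Lemma sum_absorb_backward r Z Y n : 0 <= r -> 0 <= Z 0 ->
  (forall j, Z j <= r * Z j.+1 + Y j.+1) ->
  (1 - r) * (\sum_(j < n) Z j) <= r * Z n + \sum_(j < n) Y j.+1.
Proof.
move=> r0 Z0 ZY; elim: n => [|n IH].
  by rewrite !big_ord0 mulr0 addr0 mulr_ge0.
by rewrite !big_ord_recr/=; have := ZY n; lra.
Qed.

(** A weight growing by a factor [2 r < 2] per backward step loses against the
    factors [2 ^+ i.+1], so the averages form a geometric series. *)
Lemma tail_average_le r (w a : nat -> R) B : 0 < r < 1 -> 0 <= B ->
  (forall j, 0 < w j) -> (forall j, w j <= 2 * r * w j.+1) ->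
  (forall j, 0 <= a j) -> (forall j, w j * a j <= B) ->
  forall n m, \sum_(i < m) a (n + i.+1)%N / 2 ^+ i.+1 <= B / (1 - r) / w n.
Proof.
move=> /andP[r0 r1] B0 w0 wr a0 aw.
have r1' : 0 < 1 - r by rewrite subr_gt0.
have ww m i : w m <= (2 * r) ^+ i * w (m + i)%N.
  elim: i => [|i IH]; first by rewrite expr0 mul1r addn0.
  apply: (le_trans IH); rewrite exprSr -mulrA ler_wpM2l ?addnS//.
  by rewrite exprn_ge0// mulr_ge0// ltW.
move=> m k.
apply: (@le_trans _ _ (\sum_(i < k) r ^+ i * (B / w m))); last first.
  rewrite -mulr_suml [leRHS]mulrAC mulrC ler_wpM2l ?divr_ge0 ?(ltW (w0 m))//.
  by apply: sum_geometric_lt; rewrite (ltW r0).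
apply: ler_sum => i _.
rewrite ler_pdivrMr ?exprn_gt0// mulrA mulrAC ler_pdivlMr//.
have := ww m i.+1; have := aw (m + i.+1)%N; have := a0 (m + i.+1)%N.
set A := a _; set W := w (m + _)%N => A0 WAB wW.
apply: (@le_trans _ _ ((2 * r) ^+ i.+1 * (W * A))).
  by rewrite mulrA mulrC ler_wpM2r.
apply: (@le_trans _ _ ((2 * r) ^+ i.+1 * B)).
  by rewrite ler_wpM2l// exprn_ge0// mulr_ge0// ltW.
have -> : (2 * r) ^+ i.+1 * B = r * (r ^+ i * B * 2 ^+ i.+1).
  by rewrite exprMn (exprS r); ring.
by rewrite ler_piMl ?(ltW r1)// !mulr_ge0// exprn_ge0// ltW.
Qed.

Lemma le_of_sum_powR p (x : nat -> R) B j : 0 < p -> 0 <= B ->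
  (forall j, 0 <= x j) -> (forall n, \sum_(j < n) x j `^ p <= B `^ p) ->
  x j <= B.
Proof.
move=> p0 B0 x0 xB.
have := xB j.+1; rewrite big_ord_recr/= => sB.
have {sB} wB : x j `^ p <= B `^ p.
  by apply: le_trans sB; rewrite lerDr sumr_ge0// => i _; rewrite powR_ge0.
have pV0 : 0 <= p^-1 by rewrite invr_ge0 ltW.
have := ge0_ler_powR pV0 _ _ wB; rewrite !nnegrE !powR_ge0 => /(_ isT isT).
by rewrite -!powRrM mulfV ?gt_eqF// !powRr1.
Qed.

(** The recursion [F j <= (F j.+1 + a j.+1) / 2] makes [w j * F j] contract by [r]
    at each step, and [sum_absorb_backward] sums it up to a boundary term.  The
    last but one hypothesis bounds that term: it says that [F n] is at most the
    average of the later [a j], which is what letting the recursion run to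
    infinity would give. *)
Lemma hardy_averages p r : 1 <= p -> 0 < r < 1 ->
  exists2 C : R, 0 < C & forall (w a F : nat -> R) B, 0 <= B ->
    (forall j, 0 < w j) -> (forall j, w j <= 2 * r * w j.+1) ->
    (forall j, 0 <= a j) -> (forall j, 0 <= F j) ->
    (forall j, F j <= (F j.+1 + a j.+1) / 2) ->
    (forall n b, (forall m, \sum_(i < m) a (n + i.+1)%N / 2 ^+ i.+1 <= b) ->
       F n <= b) ->
    (forall n, \sum_(j < n) (w j * a j) `^ p <= B `^ p) ->
    forall n, \sum_(j < n) (w j * F j) `^ p <= C * B `^ p.
Proof.
move=> p1 r01; have /andP[r0 r1] := r01.
have r1' : 0 < 1 - r by rewrite subr_gt0.
have p0 : 0 < p by rewrite (lt_le_trans _ p1).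
pose D := (1 - r) `^ (1 - p).
have D0 : 0 < D by rewrite powR_gt0.
exists ((1 - r)^-1 * ((1 - r)^-1 `^ p + D)).
  by rewrite mulr_gt0 ?invr_gt0// addr_gt0// powR_gt0// invr_gt0.
move=> w a F B B0 w0 wr a0 F0 Fa Ftail aB n.
have aw j : w j * a j <= B.
  by apply: (@le_of_sum_powR p (fun j => w j * a j) B j p0 B0) => // i; rewrite mulr_ge0// ltW.
have Fbound m : w m * F m <= (1 - r)^-1 * B.
  rewrite mulrC -ler_pdivlMr// [_^-1 * B]mulrC; apply: Ftail => k.
  by apply: (tail_average_le r01).
have wF j : w j * F j <= r * (w j.+1 * F j.+1) + w j.+1 * a j.+1.
  apply: (@le_trans _ _ (2 * r * w j.+1 * ((F j.+1 + a j.+1) / 2))).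
    by apply: ler_pM => //; rewrite ltW.
  have -> : 2 * r * w j.+1 * ((F j.+1 + a j.+1) / 2) =
    r * (w j.+1 * F j.+1) + r * (w j.+1 * a j.+1) by field.
  by rewrite lerD2l ler_piMl ?(ltW r1)// mulr_ge0// ltW.
have wF0 j : 0 <= w j * F j by rewrite mulr_ge0// ltW.
have wa0 j : 0 <= w j * a j by rewrite mulr_ge0// ltW.
have Z j : (w j * F j) `^ p <= r * (w j.+1 * F j.+1) `^ p +
    D * (w j.+1 * a j.+1) `^ p by apply: powR_absorb.
have := @sum_absorb_backward r _ (fun j => D * (w j * a j) `^ p) n (ltW r0)
  (powR_ge0 _ _) Z.
rewrite mulrC -ler_pdivlMr// => /le_trans; apply.
rewrite [leLHS]mulrC -[leRHS]mulrA ler_wpM2l ?invr_ge0 ?(ltW r1')// mulrDl lerD//.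
  rewrite -powRM ?invr_ge0 ?(ltW r1')//.
  apply: (@le_trans _ _ ((w n * F n) `^ p)).
    by rewrite ler_piMl ?powR_ge0// ltW.
  by apply: ge0_ler_powR; rewrite ?nnegrE// ?mulr_ge0 ?invr_ge0 ?(ltW r1') ?(ltW p0).
rewrite -mulr_sumr ler_wpM2l ?(ltW D0)//; apply: (le_trans _ (aB n.+1)).
by rewrite big_ord_recl/= lerDr powR_ge0.
Qed.

(** Let [x j = a j / j.+1] be the mean.  Multiplying the recursion for [x] by
    [x j.+1 `^ (p - 1)] and using Young's inequality for the cross term gives

      (j + 2 + (p - 1) / 2) x_(j+1)^p <= (j + 1) x_j^p + D b_(j+1)^p,

    which telescopes and leaves [(p - 1) / 2] times the sum to be estimated. *)
Lemma hardy_discrete p : 1 < p ->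
  exists2 C : R, 0 < C & forall (a b : nat -> R) n,
    (forall j, 0 <= a j) -> (forall j, 0 <= b j) ->
    (forall j, a j.+1 <= a j + b j.+1) ->
    \sum_(j < n) (a j / j.+1%:R) `^ p
      <= C * (a 0%N `^ p + \sum_(j < n) b j.+1 `^ p).
Proof.
move=> p1; have p0 : 0 < p by rewrite (lt_trans _ p1).
have p10 : 0 < p - 1 by rewrite subr_gt0.
(* The error term then costs half of the gain [(p - 1) * x `^ p] left by
   Young's inequality. *)
pose eta := (p - 1) / (2 * p).
have eta0 : 0 < eta by rewrite divr_gt0// mulr_gt0.
have etaE : eta * p = (p - 1) / 2.
  by rewrite /eta; field; rewrite gt_eqF.
pose D := p * eta `^ (1 - p).
have D0 : 0 < D by rewrite mulr_gt0// powR_gt0.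
have young x y : 0 <= x -> 0 <= y ->
    p * (x `^ (p - 1) * y) <= (p - 1) * x `^ p + y `^ p.
  move=> x0 y0; pose q := p / (p - 1).
  have q0 : 0 < q by rewrite divr_gt0.
  have := @conjugate_powR _ (x `^ (p - 1)) y q p (powR_ge0 _ _) y0 q0 p0.
  have -> : q^-1 + p^-1 = 1 by rewrite /q; field; rewrite !gt_eqF.
  move=> /(_ erefl); rewrite -powRrM.
  have -> : (p - 1) * q = p by rewrite /q; field; rewrite gt_eqF.
  rewrite -(ler_pM2l p0) => /le_trans; apply.
  by rewrite le_eqVlt; apply/orP; left; apply/eqP; rewrite /q; field; rewrite !gt_eqF.
have split_small x y : 0 <= x -> 0 <= y ->
    x `^ (p - 1) * y <= eta * x `^ p + eta `^ (1 - p) * y `^ p.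
  move=> x0 y0; have [yx|xy] := leP y (eta * x).
    apply: (@le_trans _ _ (eta * x `^ p)); last first.
      by rewrite lerDl mulr_ge0// powR_ge0.
    rewrite -(mulr_powRB1 x0 p0) mulrA mulrC ler_wpM2r ?powR_ge0//.
  apply: (@le_trans _ _ (eta `^ (1 - p) * y `^ p)); last first.
    by rewrite lerDr mulr_ge0 ?powR_ge0// ltW.
  rewrite -(mulr_powRB1 y0 p0) mulrCA [leLHS]mulrC ler_wpM2l//.
  have -> : 1 - p = - (p - 1) by ring.
  rewrite powRN mulrC ler_pdivlMr ?powR_gt0// mulrC -powRM ?(ltW eta0)//.
  have ex0 : 0 <= eta * x by apply: mulr_ge0 => //; exact: ltW.
  by apply: ge0_ler_powR; rewrite ?nnegrE ?(ltW p10) ?(ltW xy)//. 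
exists (1 + 2 / (p - 1) * (1 + D)).
  by rewrite addr_gt0// mulr_gt0 ?divr_gt0// addr_gt0.
move=> a b n a0 b0 ab.
pose x j := a j / j.+1%:R.
have x0 j : 0 <= x j by rewrite divr_ge0.
have xb j : j.+2%:R * x j.+1 <= j.+1%:R * x j + b j.+1.
  by rewrite /x 2![_%:R * (_ / _)]mulrC !divfK ?pnatr_eq0.
have step j : (j.+2%:R + (p - 1) / 2) * x j.+1 `^ p <=
    j.+1%:R * x j `^ p + D * b j.+1 `^ p.
  have := ler_wpM2l (powR_ge0 (x j.+1) (p - 1)) (xb j).
  rewrite mulrCA [x j.+1 `^ (p - 1) * _]mulrC (mulr_powRB1 (x0 _) p0) mulrDr.
  have := young _ _ (x0 j.+1) (x0 j).
  have := split_small _ _ (x0 j.+1) (b0 j.+1).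
  rewrite /D.
  have : (0 : R) <= j.+1%:R by [].
  rewrite -[j.+2]addn1 natrD.
  move: j.+1%:R (x j) (b j.+1) (eta `^ _) (x j.+1 `^ (p - 1)) (x j.+1 `^ p)
    (x j `^ p) (b j.+1 `^ p) => N X b' E U V W B.
  move=> N0 h1 h2 h3.
  have h1' : p * (U * b') <= (p - 1) / 2 * V + p * E * B.
    have -> : (p - 1) / 2 * V + p * E * B = p * (eta * V + E * B).
      by rewrite -etaE; ring.
    by rewrite ler_pM2l.
  have h2' := ler_wpM2l N0 h2.
  have h3' := ler_wpM2l (ltW p0) h3.
  nra.
have tele : (p - 1) / 2 * (\sum_(j < n) x j.+1 `^ p) + n.+1%:R * x n `^ p <=
    a 0%N `^ p + D * (\sum_(j < n) b j.+1 `^ p).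
  elim: n => [|n IH]; first by rewrite !big_ord0 !mulr0 add0r addr0 mul1r /x divr1.
  by rewrite !big_ord_recr/= !mulrDr; have := step n; rewrite mulrDl; lra.
have X0 : x 0%N `^ p = a 0%N `^ p by rewrite /x divr1.
set S := \sum_(j < n) b j.+1 `^ p in tele *.
set Z := \sum_(j < n) x j.+1 `^ p in tele.
have S0 : 0 <= S by apply: sumr_ge0 => i _; exact: powR_ge0.
have A0 : 0 <= a 0%N `^ p by exact: powR_ge0.
have Zle : Z <= 2 / (p - 1) * (a 0%N `^ p + D * S).
  rewrite -ler_pdivrMl ?divr_gt0// invf_div; apply: le_trans tele.
  by rewrite lerDl mulr_ge0// powR_ge0.
apply: (@le_trans _ _ (a 0%N `^ p + Z)).
  apply: (@le_trans _ _ (\sum_(j < n.+1) x j `^ p)).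
    by rewrite big_ord_recr/= lerDl powR_ge0.
  by rewrite big_ord_recl/= X0.
apply: (le_trans (lerD (lexx _) Zle)).
have : 0 <= 2 / (p - 1) by rewrite divr_ge0// ltW.
have := ltW D0; have := mulr_ge0 (ltW D0) A0.
move: (2 / _) (a 0%N `^ p) A0 => E A A0 DA D0' E0.
have : 0 <= E * S by rewrite mulr_ge0.
have : 0 <= E * (D * A) by rewrite mulr_ge0.
nra.
Qed.

Lemma bounded_of_geometric_increments r K (a : nat -> R) n :
  0 <= r < 1 -> 0 <= K -> (forall j, a j.+1 <= a j + K * r ^+ j) ->
  a n <= a 0%N + K / (1 - r).
Proof.
move=> r01 K0 aK.
have : a n <= a 0%N + K * \sum_(i < n) r ^+ i.
  elim: n => [|n IH]; first by rewrite big_ord0 mulr0 addr0.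
  by rewrite big_ord_recr/= mulrDr; have := aK n; lra.
move=> /le_trans; apply; rewrite lerD2l ler_wpM2l//.
exact: sum_geometric_lt.
Qed.

End RealSequences.

(** * Integrals over dyadic decompositions *)

Section DyadicIntegral.
Context {R : realType}.
Local Open Scope ereal_scope.
Notation leb := (@lebesgue_measure R).

(** Preimages of rays under a monotone function are intervals.  Rearrangements
    are monotone on the whole line only as extended-real functions, with value
    [+oo] at negative arguments. *)
Lemma nonincreasing_emeasurable (D : set R) (f : R -> \bar R) : measurable D ->
  (forall x y, (x <= y)%R -> f y <= f x) -> measurable_fun D f.
Proof.
move=> mD f_ni.
apply: (measurability (@ErealGenCInfty.G R)) => [|/= _ [_] [r] -> <-].
  exact: ErealGenCInfty.measurableE.
apply: measurableI => //; apply: is_interval_measurable => s t/=.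
rewrite !in_itv/= !andbT => fs ft u /andP[su ut].
by rewrite in_itv/= andbT (le_trans ft)// f_ni.
Qed.

Lemma nondecreasing_emeasurable (D : set R) (f : R -> \bar R) : measurable D ->
  (forall x y, (x <= y)%R -> f x <= f y) -> measurable_fun D f.
Proof.
move=> mD f_nd.
apply: (measurability (@ErealGenCInfty.G R)) => [|/= _ [_] [r] -> <-].
  exact: ErealGenCInfty.measurableE.
apply: measurableI => //; apply: is_interval_measurable => s t/=.
rewrite !in_itv/= !andbT => fs ft u /andP[su ut].
by rewrite in_itv/= andbT (le_trans fs)// f_nd.
Qed.

Lemma bigcup_dyadic (T : R) : (0 < T)%R ->
  \bigcup_n `[(T / 2 ^+ n)%R, T[%classic = `]0%R, T[%classic.
Proof.
move=> T0; apply/seteqP; split => [t [n _]|t] /=; rewrite !in_itv/= => /andP[nt tT].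
  by rewrite tT andbT (lt_le_trans _ nt)// divr_gt0// exprn_gt0.
have [n nP] : exists n : nat, (T / t <= 2 ^+ n)%R.
  by exists (Num.Def.archi_bound (T / t)); apply/ltW/upper_nthrootP.
exists n => //=; rewrite in_itv/= tT andbT.
by rewrite ler_pdivrMr ?exprn_gt0// mulrC -ler_pdivrMr.
Qed.

(** This is how integrals enter the proof: every one of them is bounded by a
    dyadic sum, and only through its partial sums. *)
Lemma integral_dyadic_le (Phi : R -> \bar R) (c : nat -> R) (T B : R) :
  (0 < T)%R -> measurable_fun `]0%R, T[ Phi ->
  (forall t, (0 < t < T)%R -> 0 <= Phi t) ->
  (forall j t, (T / 2 ^+ j.+1 <= t < T / 2 ^+ j)%R -> Phi t <= (c j)%:E) ->
  (forall n, \sum_(j < n) T / 2 ^+ j.+1 * c j <= B)%R ->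
  \int[leb]_(t in `]0%R, T[) Phi t <= B%:E.
Proof.
move=> T0 mPhi Phi0 Phic cB.
have d0 n : (0 < T / 2 ^+ n :> R)%R by rewrite divr_gt0// exprn_gt0.
have dS n : (T / 2 ^+ n = 2 * (T / 2 ^+ n.+1) :> R)%R.
  by rewrite exprS; field; rewrite expf_neq0.
have dle n : (T / 2 ^+ n.+1 <= T / 2 ^+ n :> R)%R.
  by rewrite (dS n) ler_peMl ?(ltW (d0 _)) ?ler1n//.
have dT n : (T / 2 ^+ n <= T :> R)%R.
  by rewrite ler_pdivrMr ?exprn_gt0// ler_peMr ?(ltW T0)// exprn_ege1// ler1n.
pose F n := `[(T / 2 ^+ n)%R, T[%classic.
have sF n : F n `<=` `]0%R, T[%classic.
  by rewrite -(bigcup_dyadic T0); exact: bigcup_sup.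
have mF n : measurable_fun (F n) Phi by apply: measurable_funS mPhi => //; exact: sF.
have F0 n t : F n t -> 0 <= Phi t.
  by move=> /sF/=; rewrite in_itv/=; exact: Phi0.
have ndF : nondecreasing_seq F.
  apply/nondecreasing_seqP => n; apply/subsetPset => t; rewrite /F /= !in_itv/=.
  by move=> /andP[nt ->]; rewrite andbT (le_trans (dle n)).
have intF n : \int[leb]_(t in F n) Phi t <= (\sum_(j < n) T / 2 ^+ j.+1 * c j)%:E.
  elim: n => [|n IH].
    by rewrite /F expr0 divr1 set_itvco0// integral_set0 big_ord0.
  have FS : F n.+1 = `[(T / 2 ^+ n.+1)%R, (T / 2 ^+ n)%R[ `|` F n.
    apply/seteqP; split => t; rewrite /F /= !in_itv/=.
      move=> /andP[nt tT]; case: (ltP t (T / 2 ^+ n)%R) => [tn|nt'].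
        by left; rewrite nt.
      by right; rewrite tT.
    move=> [/andP[-> tn]|/andP[nt ->]].
      by rewrite (lt_le_trans tn).
    by rewrite (le_trans (dle n)).
  rewrite FS ge0_integral_setU//=; last 4 first.
  - exact: measurable_itv.
  - by rewrite -FS; exact: mF.
  - by move=> x xF; apply: (F0 n.+1); rewrite FS.
  - apply/disj_setPS => t []; rewrite /F /= !in_itv/= => /andP[_ tn] /andP[nt _].
    by move: tn; rewrite ltNge nt.
  rewrite big_ord_recr/= addrC EFinD leeD//.
  apply: (@le_trans _ _ (\int[leb]_(t in `[(T / 2 ^+ n.+1)%R, (T / 2 ^+ n)%R[) (c n)%:E)).
    apply: ge0_le_integral => //=.
    - by move=> x xI; apply: (F0 n.+1); rewrite FS; left.
    - apply: (measurable_funS _ _ (mF n.+1)); first exact: measurable_itv.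
      by rewrite FS; left.
    - by move=> x; rewrite in_itv/=; exact: Phic.
  rewrite integral_cst//= lebesgue_measure_itv/= lte_fin.
  rewrite ifT; last by rewrite (dS n) ltr_pMl// ltr1n.
  by rewrite -EFinB -EFinM lee_fin {1}(dS n); lra.
have mI n : measurable (F n) by exact: measurable_itv.
have : \int[leb]_(x in F i) Phi x @[i --> \oo] -->
    \int[leb]_(x in \bigcup_i F i) Phi x.
  exact: ge0_nondecreasing_set_cvg_integral.
rewrite bigcup_dyadic// => /cvg_lim <-//.
apply: lime_le.
  apply: ereal_nondecreasing_is_cvgn.
  exact: ge0_nondecreasing_set_nondecreasing_integral.
apply: nearW => n; apply: (le_trans (intF n)); rewrite lee_fin; exact: cB.
Qed.

End DyadicIntegral.

(** * Rearrangements and the layer-cake inequality *)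

Section Rearrangement.
Context {R : realType} {d : measure_display} {T : measurableType d}.
Variable mu : {measure set T -> \bar R}.
Local Open Scope ereal_scope.
Implicit Types (f : T -> R) (t l : R).

Lemma measurable_superlevel f l : measurable_fun setT f ->
  measurable [set x | (l < `|f x|)%R].
Proof.
move=> mf; have mnf : measurable_fun setT (Num.norm \o f) by exact: measurableT_comp.
rewrite [X in measurable X](_ : _ = setT `&` (Num.norm \o f) @^-1` `]l, +oo[%classic).
  exact: mnf.
by rewrite setTI; apply/seteqP; split => x /=; rewrite in_itv/= andbT.
Qed.

Lemma rearrangement_ge0 f t : 0 <= rearrangement mu f t.
Proof. by apply: le_ereal_inf_tmp => _ [l [l0 _] <-]; rewrite lee_fin. Qed.

Lemma rearrangement_le f t l : (0 <= l)%R ->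
  mu [set x | (l < `|f x|)%R] <= t%:E -> rearrangement mu f t <= l%:E.
Proof. by move=> l0 ml; apply: ereal_inf_lbound; exists l. Qed.

Lemma lt_rearrangement f t l : (0 <= l)%R -> l%:E < rearrangement mu f t ->
  t%:E < mu [set x | (l < `|f x|)%R].
Proof.
by move=> l0 lf; rewrite ltNge; apply/negP => /(rearrangement_le l0); rewrite leNgt lf.
Qed.

Lemma rearrangement_lt f t l : measurable_fun setT f ->
  rearrangement mu f t < l%:E -> mu [set x | (l < `|f x|)%R] <= t%:E.
Proof.
move=> mf /ereal_inf_lt[_ [m [m0 mt] <-]]; rewrite lte_fin => ml.
apply: le_trans mt; apply: le_measure; rewrite ?inE; [exact: measurable_superlevel..|].
by move=> x /=; apply: lt_trans.
Qed.

Lemma rearrangement_nonincreasing f (s t : R) : (s <= t)%R ->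
  rearrangement mu f t <= rearrangement mu f s.
Proof.
move=> st; apply: ereal_inf_le_tmp => _ [l [l0 ls] <-]; exists l => //; split => //.
by rewrite (le_trans ls)// lee_fin.
Qed.

(** The part of the integral of [phi] that lies above the level [l]. *)
Definition excess (phi : T -> R) l := \int[mu]_x (Num.max (phi x - l)%R 0%R)%:E.

Lemma measurable_excess (phi : T -> R) l : measurable_fun setT phi ->
  measurable_fun setT (fun x => (Num.max (phi x - l)%R 0%R)%:E).
Proof.
move=> mphi; apply/measurable_EFinP; apply: measurable_maxr => //.
exact: measurable_funB.
Qed.

(** Lowering the level from [a] to [b] adds at least [a - b] on the set where
    [phi] exceeds [a]. *)
Lemma excess_step (phi : T -> R) (a b t : R) : measurable_fun setT phi ->
  (b <= a)%R -> ((b < a)%R -> t%:E <= mu [set x | (a < phi x)%R]) ->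
  excess phi a + ((a - b) * t)%:E <= excess phi b.
Proof.
move=> mphi; rewrite le_eqVlt => /predU1P[->|ba /(_ ba) ta].
  by rewrite subrr mul0r adde0.
pose D := [set x | (a < phi x)%R].
have mD : measurable D.
  rewrite [D](_ : _ = setT `&` phi @^-1` `]a, +oo[%classic); first exact: mphi.
  by rewrite setTI; apply/seteqP; split => x /=; rewrite in_itv/= andbT.
have ab0 : (0 <= a - b)%R by rewrite subr_ge0 ltW.
have mI : measurable_fun setT (fun x => ((a - b) * \1_D x)%:E).
  by apply/measurable_EFinP; apply: measurable_funM => //; exact: measurable_indic.
apply: (@le_trans _ _ (excess phi a + \int[mu]_x ((a - b) * \1_D x)%:E)).
  rewrite leeD2l// (@integralZl_indic _ _ _ mu setT measurableT (fun=> D))//; last first.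
    by move=> ab1; move: ab0; rewrite leNgt ab1.
  by rewrite integral_indic// setIT EFinM lee_wpmul2l// lee_fin.
rewrite -ge0_integralD//; last 3 first.
- by move=> x _; rewrite lee_fin le_max lexx orbT.
- exact: measurable_excess.
- by move=> x _; rewrite lee_fin mulr_ge0.
apply: ge0_le_integral => //=.
- move=> x _; rewrite -EFinD lee_fin addr_ge0 ?mulr_ge0//.
  by rewrite le_max lexx orbT.
- by apply: emeasurable_funD => //; exact: measurable_excess.
- exact: measurable_excess.
move=> x _; rewrite -EFinD lee_fin indicE; have [xD|xD] := boolP (x \in D).
  move: xD; rewrite inE /D /= => ax; rewrite mulr1 !max_l; lra.
have h : (phi x - a <= phi x - b)%R by rewrite lerB// ltW.
by rewrite mulr0 addr0 ge_max !le_max h lexx orbT.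
Qed.

(** The levels [l j] rise while the masses [t0 / 2 ^+ j] fall.  Lowering the level
    of [excess] from [l j] to [l j.-1] gains [(l j - l j.-1) * (t0 / 2 ^+ j)], and
    summation by parts turns these gains into the sum of the
    [l j * (t0 / 2 ^+ j - t0 / 2 ^+ j.+1)]. *)
Lemma sum_layers_le_integral (phi : T -> R) (l : nat -> R) (t0 : R) n :
  measurable_fun setT phi ->
  (forall x, (0 <= phi x)%R) -> (0 <= t0)%R -> (0 <= l 0%N)%R ->
  (forall j, (l j <= l j.+1)%R) ->
  (forall j, (0 < l j)%R -> (t0 / 2 ^+ j)%:E <= mu [set x | (l j < phi x)%R]) ->
  (\sum_(j < n) l j * (t0 / 2 ^+ j.+1))%:E <= \int[mu]_x (phi x)%:E.
Proof.
move=> mphi phi0 t00 l0 ll lt.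
have lj j : (0 <= l j)%R by elim: j => // j IH; rewrite (le_trans IH).
have tS j : (t0 / 2 ^+ j = 2 * (t0 / 2 ^+ j.+1) :> R)%R.
  by rewrite exprS; field; rewrite expf_neq0.
have e0 a : 0 <= excess phi a.
  by apply: integral_ge0 => x _; rewrite lee_fin le_max lexx orbT.
have intE : \int[mu]_x (phi x)%:E = excess phi 0.
  by apply: eq_integral => x _; rewrite subr0 max_l.
case: n => [|n]; first by rewrite big_ord0 intE.
(* The summand outside the sum is the boundary term of the summation by parts. *)
suff : (\sum_(j < n.+1) l j * (t0 / 2 ^+ j.+1) + l n * (t0 / 2 ^+ n.+1))%:E +
    excess phi (l n) <= \int[mu]_x (phi x)%:E.
  apply: le_trans; rewrite -[leLHS]adde0 leeD// lee_fin lerDl.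
  by rewrite mulr_ge0// divr_ge0// exprn_ge0.
elim: n => [|n IH].
  rewrite big_ord1 -mulrDr intE addeC.
  have -> : (l 0%N * (t0 / 2 ^+ 1 + t0 / 2 ^+ 1) = (l 0%N - 0) * (t0 / 2 ^+ 0))%R.
    by rewrite (tS 0%N); ring.
  by apply: excess_step => // /lt; apply.
apply: le_trans IH.
rewrite big_ord_recr/=.
set S := (\sum_(j < n.+1) _)%R.
have -> : (S + l n.+1 * (t0 / 2 ^+ n.+2) + l n.+1 * (t0 / 2 ^+ n.+2) =
  S + l n * (t0 / 2 ^+ n.+1) + (l n.+1 - l n) * (t0 / 2 ^+ n.+1))%R.
  by rewrite (tS n.+1); ring.
rewrite EFinD -addeA leeD2l// addeC; apply: excess_step => // ln.
by apply: lt; rewrite (le_lt_trans (lj n)).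
Qed.

End Rearrangement.

(** * Rearrangements of functions in Lebesgue spaces *)

Section LpRearrangement.
Context {R : realType} {d : measure_display} {T : measurableType d}.
Variable mu : {measure set T -> \bar R}.
Local Open Scope ereal_scope.
Implicit Types (f : T -> R) (t l : R).

(** On the spaces [Lfun mu p] the rearrangement is finite at positive arguments
    ([rearrE]), so real arithmetic applies. *)
Definition rearr f t := fine (rearrangement mu f t).

Lemma Lfun_measurable p f : f \in Lfun mu p -> measurable_fun setT f.
Proof. by move=> /sub_Lfun_mfun; rewrite inE. Qed.

Lemma Lfun_Lnorm_fin p f : f \in Lfun mu p -> 'N[mu]_p[EFin \o f] \is a fin_num.
Proof.
move=> /sub_Lfun_finLfun; rewrite inE /finite_norm => fp.
by rewrite ge0_fin_numE// Lnorm_ge0.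
Qed.

Lemma integral_powR_Lnorm (p : R) f : (0 < p)%R -> f \in Lfun mu p%:E ->
  \int[mu]_x (`|f x| `^ p)%:E = (fine 'N[mu]_p%:E[EFin \o f] `^ p)%:E.
Proof.
move=> p0 fp; rewrite -poweR_EFin fineK ?Lfun_Lnorm_fin// poweR_Lnorm ?gt_eqF//.
Qed.

Lemma superlevel_powR (p : R) f l : (0 < p)%R -> (0 <= l)%R ->
  [set x | (l < `|f x|)%R] = [set x | (l `^ p < `|f x| `^ p)%R].
Proof.
move=> p0 l0; apply/seteqP; split => x /=.
  by apply: gt0_ltr_powR; rewrite ?nnegrE.
apply: contraPP => /negP; rewrite -leNgt => fl; apply/negP; rewrite -leNgt.
by apply: ge0_ler_powR; rewrite ?nnegrE// ltW.
Qed.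

Lemma measurable_norm_powR (p : R) f : measurable_fun setT f ->
  measurable_fun setT (fun x => `|f x| `^ p)%R.
Proof.
move=> mf; apply: (measurableT_comp (measurable_powR p)).
exact: measurableT_comp.
Qed.

Lemma rearrangement_le_Linfty f t : 0 < mu setT -> f \in Lfun mu +oo -> (0 <= t)%R ->
  rearrangement mu f t <= 'N[mu]_+oo[EFin \o f].
Proof.
move=> muT fp t0; rewrite -[leRHS]fineK ?Lfun_Lnorm_fin//.
apply: rearrangement_le; first exact/fine_ge0/Lnorm_ge0.
have [N [mN N0 fN]] := ess_sup_ge mu (abse \o (EFin \o f)).
apply: (@le_trans _ _ 0); last by rewrite lee_fin.
rewrite -N0; apply: le_measure; rewrite ?inE//.
  apply: measurable_superlevel; exact: Lfun_measurable fp.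
move=> x /= fx; apply: fN => /=; apply/negP; rewrite -ltNge.
have : (fine 'N[mu]_+oo[EFin \o f])%:E < `|f x|%:E by rewrite lte_fin.
by rewrite fineK ?Lfun_Lnorm_fin// unlock muT.
Qed.

(** An infinite value at [t] would put mass at least [t] above every level,
    against the finiteness of the integral of [`|f| `^ p]. *)
Lemma rearrangement_fin_num p f t : 0 < mu setT -> 1 <= p -> f \in Lfun mu p ->
  (0 < t)%R -> rearrangement mu f t \is a fin_num.
Proof.
move=> muT p1 fp t0; rewrite ge0_fin_numE ?rearrangement_ge0//.
have mf := Lfun_measurable fp.
case: p p1 fp => [p||]; rewrite ?lee_fin// => p1 fp; last first.
  rewrite (le_lt_trans (rearrangement_le_Linfty muT fp (ltW t0)))//.
  by rewrite -ge0_fin_numE ?Lnorm_ge0 ?Lfun_Lnorm_fin.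
have p0 : (0 < p)%R by rewrite (lt_le_trans _ p1).
have mphi := measurable_norm_powR p mf.
rewrite ltNge leye_eq; apply/negP => /eqP foo.
set M := fine 'N[mu]_p%:E[EFin \o f].
(* At this level Chebyshev's inequality would read [M `^ p + 1 <= M `^ p]. *)
pose l := (((M `^ p + 1) / t) `^ p^-1)%R.
have l0 : (0 <= l)%R by exact: powR_ge0.
have lE : (l `^ p = (M `^ p + 1) / t)%R.
  by rewrite -powRrM mulVf ?gt_eqF// powRr1// divr_ge0 ?(ltW t0)// addr_ge0 ?powR_ge0.
have : t%:E < mu [set x | (l < `|f x|)%R] by apply: lt_rearrangement; rewrite // foo ltry.
rewrite (superlevel_powR _ p0 l0) => /ltW tl.
have := @excess_step _ _ _ mu (fun x => `|f x| `^ p)%R (l `^ p)%R 0%R t mphi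
  (powR_ge0 _ _) (fun _ => tl).
apply/negP; rewrite -ltNge.
apply: (@lt_le_trans _ _ ((l `^ p - 0) * t)%:E); last first.
  by rewrite leeDr// integral_ge0// => x _; rewrite lee_fin le_max lexx orbT.
rewrite subr0 lE divfK ?gt_eqF//.
have -> : excess mu (fun x => `|f x| `^ p)%R 0 = (M `^ p)%:E.
  rewrite -integral_powR_Lnorm//; apply: eq_integral => x _.
  by rewrite subr0 max_l// powR_ge0.
by rewrite lte_fin ltrDl.
Qed.

Lemma rearr_ge0 f t : (0 <= rearr f t)%R.
Proof. exact/fine_ge0/rearrangement_ge0. Qed.

Lemma rearrE p f t : 0 < mu setT -> 1 <= p -> f \in Lfun mu p ->
  (0 < t)%R -> (rearr f t)%:E = rearrangement mu f t.
Proof. by move=> muT p1 fp t0; rewrite fineK// (rearrangement_fin_num muT p1 fp). Qed.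

Lemma le_rearr p f s t : 0 < mu setT -> 1 <= p -> f \in Lfun mu p ->
  (0 < s)%R -> (s <= t)%R -> (rearr f t <= rearr f s)%R.
Proof.
move=> muT p1 fp s0 st; rewrite -lee_fin !(rearrE muT p1 fp)//.
  exact: rearrangement_nonincreasing.
exact: lt_le_trans st.
Qed.

(** A dyadic substitute for the equality of the [L^p] norms of [f] and of its
    rearrangement. *)
Lemma sum_rearr_powR_le_Lnorm (p : R) f t0 n : 0 < mu setT -> (1 <= p)%R ->
  f \in Lfun mu p%:E ->
  (0 < t0)%R ->
  (\sum_(j < n) t0 / 2 ^+ j * rearr f (t0 / 2 ^+ j) `^ p
    <= 2 * 2 `^ p * fine 'N[mu]_p%:E[EFin \o f] `^ p)%R.
Proof.
move=> muT p1 fp t00; have p0 : (0 < p)%R by rewrite (lt_le_trans _ p1).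
have mf := Lfun_measurable fp.
have p1' : 1 <= p%:E by rewrite lee_fin.
have tj j : (0 < t0 / 2 ^+ j)%R by rewrite divr_gt0// exprn_gt0.
(* Halving the values makes them strictly smaller than the rearrangement, so
   that the superlevel sets have mass more than [t0 / 2 ^+ j]. *)
pose l j := ((rearr f (t0 / 2 ^+ j) / 2) `^ p)%R.
have r20 j : (0 <= rearr f (t0 / 2 ^+ j) / 2)%R by rewrite divr_ge0// rearr_ge0.
have lS j : (l j <= l j.+1)%R.
  apply: ge0_ler_powR; rewrite ?nnegrE ?(ltW p0)//.
  rewrite ler_pM2r ?invr_gt0//; apply: (le_rearr muT p1' fp) => //.
  by rewrite ler_pM2l// lef_pV2 ?posrE ?exprn_gt0// ler_eXn2l// ltr1n.
have := @sum_layers_le_integral _ _ _ mu _ l t0 n (measurable_norm_powR p mf)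
  (fun=> powR_ge0 _ _) (ltW t00) (powR_ge0 _ _) lS.
have ltl j : (0 < l j)%R -> (t0 / 2 ^+ j)%:E <= mu [set x | (l j < `|f x| `^ p)%R].
  move=> lj; rewrite /l -superlevel_powR//.
  apply/ltW/lt_rearrangement => //; rewrite -(rearrE muT p1' fp)// lte_fin.
  have : (0 < rearr f (t0 / 2 ^+ j) / 2)%R by apply: gt0_powR p0 _ lj.
  lra.
move=> /(_ ltl); rewrite integral_powR_Lnorm// lee_fin.
rewrite -(ler_pM2l (_ : 0 < 2 * 2 `^ p)%R) ?mulr_gt0 ?powR_gt0//.
apply: le_trans; rewrite mulr_sumr le_eqVlt; apply/orP; left; apply/eqP.
apply: eq_bigr => j _; rewrite /l powRM ?rearr_ge0 ?invr_ge0//.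
have -> : (2^-1 `^ p = (2 `^ p)^-1 :> R)%R.
  by rewrite -powR_inv1// -powRrM mulN1r powRN.
rewrite exprS; field.
by rewrite expf_neq0// gt_eqF// powR_gt0.
Qed.

(** The first term alone of [sum_rearr_powR_le_Lnorm]; for [p = +oo] it is the
    bound of the rearrangement by the essential supremum. *)
Lemma rearr_weak_type p f t : 0 < mu setT -> 1 <= p -> f \in Lfun mu p ->
  (0 < t)%R -> (t `^ fine p^-1 * rearr f t <= 4 * fine 'N[mu]_p[EFin \o f])%R.
Proof.
move=> muT p1 fp t0; have N0 : (0 <= fine 'N[mu]_p[EFin \o f])%R.
  exact/fine_ge0/Lnorm_ge0.
case: p p1 fp N0 => [p||]// p1 fp N0; last first.
  rewrite invey/= powRr0 mul1r; apply: (@le_trans _ _ (fine 'N[mu]_+oo[EFin \o f])).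
    rewrite -lee_fin (rearrE muT p1 fp)// fineK ?Lfun_Lnorm_fin//.
    exact: rearrangement_le_Linfty (ltW t0).
  lra.
rewrite lee_fin in p1; have p0 : (0 < p)%R by rewrite (lt_le_trans _ p1).
rewrite inver gt_eqF//=.
have := sum_rearr_powR_le_Lnorm 1 muT p1 fp t0; rewrite big_ord1 expr0 divr1 => h.
have pV0 : (0 <= p^-1)%R by rewrite invr_ge0 ltW.
have := ge0_ler_powR pV0 _ _ h; rewrite !nnegrE.
rewrite !mulr_ge0 ?powR_ge0 ?(ltW t0)// => /(_ isT isT).
rewrite !powRM ?powR_ge0 ?mulr_ge0 ?(ltW t0)//.
rewrite -!(powRrM _ p) mulfV ?gt_eqF// !powRr1 ?rearr_ge0//.
move=> /le_trans; apply; rewrite ler_wpM2r//.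
have : (2 `^ p^-1 <= 2 :> R)%R by rewrite ler1_powR ?ler1n// invf_le1.
lra.
Qed.

End LpRearrangement.

(** * The oscillation inequality *)

Section KeyEstimate.
Context {R : realType} {d : measure_display} {T : metricMeasurableType R d}.
Variable mu : {measure set T -> \bar R}.
Local Open Scope ereal_scope.

Lemma measurable_ball (x : T) (r : R) : metric_measure_space mu -> (0 < r)%R ->
  measurable (ball x r).
Proof.
move=> [-> _ _ _] r0; apply: sub_sigma_algebra.
rewrite /= openE => y; rewrite ballEmdist/= => xy.
apply/nbhs_ballP; exists (r - mdist x y)%R => /=; first by rewrite subr_gt0.
move=> z; rewrite !ballEmdist/= => yz.
by rewrite (le_lt_trans (metric_triangle _ y _))// addrC -ltrBrDr.
Qed.

(** Almost continuity prescribes the mass of the ball, and the lower bound then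
    limits its radius. *)
Lemma radius_le (c alpha s t : R) (x : T) : (0 < alpha)%R -> (0 < s)%R ->
  almost_continuous mu c -> lower_bounded mu alpha -> (0 < t)%R ->
  exists2 r : R, (0 < r)%R & t%:E <= mu (ball x r) /\
    (r `^ s <= (c * t) `^ (s / alpha))%R.
Proof.
move=> a0 s0 hc hl t0; have [r r0 /andP[tr rt]] := hc t x t0.
exists r => //; split => //.
have ra : (r `^ alpha <= c * t)%R by rewrite -lee_fin (le_trans (hl x r r0)).
have -> : (r `^ s = (r `^ alpha) `^ (s / alpha))%R.
  by rewrite -powRrM mulrCA divff ?mulr1// gt_eqF.
apply: ge0_ler_powR; rewrite ?nnegrE ?powR_ge0//.
  by rewrite divr_ge0// ltW.
by rewrite (le_trans _ ra)// powR_ge0.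
Qed.

(** A ball around [x] of mass at least [3 t] is not covered by the sets where [f]
    and [g] exceed their rearrangements at [t], whose masses are at most [t]
    each, together with a null set.  Comparing [f x] with [f y] for an
    uncovered point [y] bounds [|f x|] by an affine function of [g x], and
    superlevel sets of [f] lie in superlevel sets of [g]. *)
Lemma oscillation_estimate (c alpha s : R) p (f g : T -> R) :
  metric_measure_space mu -> (1 <= c)%R -> almost_continuous mu c ->
  (0 < alpha)%R -> lower_bounded mu alpha -> (0 < s)%R -> 1 <= p ->
  f \in Lfun mu p -> sgradient mu s p f g ->
  forall z t : R, (0 < z)%R -> (0 < t)%R ->
  (rearr mu f z <= rearr mu f t +
    (3 * c) `^ (s / alpha) * t `^ (s / alpha) * (rearr mu g z + rearr mu g t))%R.
Proof.
move=> hO c1 hc a0 hl s0 p1 fp [gp g0 [E [N [mN N0 EN]] fg]] z t z0 t0.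
have muT : 0 < mu setT by have [_ _ -> _] := hO; rewrite ltry.
have c0 : (0 <= c)%R by rewrite (le_trans _ c1).
rewrite -powRM ?(ltW t0) ?mulr_ge0//.
set Q := ((3 * c * t) `^ (s / alpha))%R.
have Q0 : (0 <= Q)%R by exact: powR_ge0.
have mf := Lfun_measurable fp; have mg := Lfun_measurable gp.
apply/ler_addgt0Pr => e' e'0.
(* The superlevel sets are only known to have mass at most [t] above the
   rearrangement, so all levels are raised by [e]. *)
pose e := (e' / (1 + 2 * Q))%R.
have Q12 : (0 < 1 + 2 * Q)%R by rewrite ltr_pwDl// mulr_ge0.
have e0 : (0 < e)%R by rewrite divr_gt0.
have small (h : T -> R) (u : R) : h \in Lfun mu p -> (0 < u)%R ->
    mu [set x | (rearr mu h u + e < `|h x|)%R] <= u%:E.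
  move=> hp u0; apply: rearrangement_lt; first exact: Lfun_measurable hp.
  by rewrite -(rearrE muT p1 hp)// lte_fin ltrDl.
have pointwise x : ~ N x ->
    (`|f x| <= rearr mu f t + e + Q * (g x + (rearr mu g t + e)))%R.
  move=> Nx.
  have t30 : (0 < 3 * t)%R by rewrite mulr_gt0.
  have [r r0 [tr rs]] := radius_le x a0 s0 hc hl t30.
  pose F := [set x | (rearr mu f t + e < `|f x|)%R].
  pose G := [set x | (rearr mu g t + e < `|g x|)%R].
  have mF : measurable F by exact: measurable_superlevel.
  have mG : measurable G by exact: measurable_superlevel.
  have mU : mu (F `|` G `|` N) <= (t + t)%:E.
    have UN : mu (F `|` G `|` N) <= mu (F `|` G) + mu N.
      by apply: measureU2 => //; exact: measurableU.
    have FG : mu (F `|` G) <= mu F + mu G by exact: measureU2.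
    apply: (le_trans UN); rewrite N0 adde0; apply: (le_trans FG).
    by rewrite EFinD leeD// small.
  have [y By Uy] : exists2 y, ball x r y & ~ (F `|` G `|` N) y.
    apply: contrapT => h.
    have BU : ball x r `<=` F `|` G `|` N.
      by move=> y By; apply: contrapT => Uy; apply: h; exists y.
    have : (3 * t)%:E <= (t + t)%:E.
      apply: (le_trans tr); apply: le_trans mU; apply: le_measure => //; rewrite inE.
        exact: measurable_ball.
      by apply: measurableU => //; exact: measurableU.
    by rewrite lee_fin; lra.
  have Fy : (`|f y| <= rearr mu f t + e)%R.
    by rewrite leNgt; apply/negP => h; apply: Uy; left; left.
  have Gy : (g y <= rearr mu g t + e)%R.
    rewrite leNgt; apply/negP => h; apply: Uy; left; right.
    by rewrite /G /= ger0_norm.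
  have := fg x y (fun Ex => Nx (EN _ Ex)) (fun Ey => Uy (or_intror (EN _ Ey))).
  have dQ : (mdist x y `^ s <= Q)%R.
    rewrite /Q -(mulrC c) -mulrA; apply: le_trans rs.
    apply: ge0_ler_powR; rewrite ?nnegrE ?mdist_ge0 ?(ltW s0) ?(ltW r0)//.
    by move: By; rewrite ballEmdist/= => /ltW.
  move=> fxy; have := ler_normD (f y) (f x - f y)%R; rewrite addrC subrK.
  move=> /le_trans; apply; apply: lerD => //; apply: (le_trans fxy).
  apply: ler_pM => //; first exact: powR_ge0.
    by rewrite addr_ge0.
  by rewrite lerD2l.
pose L := (rearr mu f t + e + Q * ((rearr mu g z + e) + (rearr mu g t + e)))%R.
have L0 : (0 <= L)%R.
  by rewrite /L !addr_ge0 ?rearr_ge0 ?(ltW e0)// mulr_ge0// !addr_ge0 ?rearr_ge0 ?(ltW e0).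
have : rearrangement mu f z <= L%:E.
  apply: rearrangement_le => //.
  apply: (@le_trans _ _ (mu ([set x | (rearr mu g z + e < `|g x|)%R] `|` N))).
    apply: le_measure; rewrite ?inE.
    - exact: measurable_superlevel.
    - by apply: measurableU => //; exact: measurable_superlevel.
    move=> x /= Lx; apply: contrapT => /not_orP[/= /negP gx Nx].
    move: Lx; apply/negP; rewrite -leNgt; apply: (le_trans (pointwise x Nx)).
    rewrite lerD2l ler_wpM2l// lerD2r.
    by move: gx; rewrite -leNgt ger0_norm.
  have GN : mu ([set x | (rearr mu g z + e < `|g x|)%R] `|` N) <=
      mu [set x | (rearr mu g z + e < `|g x|)%R] + mu N.
    by apply: measureU2 => //; exact: measurable_superlevel.
  by apply: (le_trans GN); rewrite N0 adde0 small.
rewrite -(rearrE muT p1 fp)// lee_fin => /le_trans; apply.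
have -> : e' = (e * (1 + 2 * Q))%R by rewrite /e divfK// gt_eqF.
rewrite /L; lra.
Qed.

End KeyEstimate.

(** * The maximal rearrangement *)

Section MaxRearrangement.
Context {R : realType} {d : measure_display} {T : measurableType d}.
Variable mu : {measure set T -> \bar R}.
Local Open Scope ereal_scope.
Notation leb := (@lebesgue_measure R).
Hypothesis muT : 0 < mu setT.
Variables (p : \bar R) (p1 : 1 <= p).
Implicit Types (f : T -> R) (t : R).

Let J f t := \int[leb]_(z in `]0%R, t[) rearrangement mu f z.

Lemma measurable_rearrangement f (D : set R) : measurable D ->
  measurable_fun D (rearrangement mu f).
Proof.
by move=> mD; apply: nonincreasing_emeasurable => // x y; exact: rearrangement_nonincreasing.
Qed.

Lemma max_rearrangement_ge0 f t : (0 <= t)%R -> 0 <= max_rearrangement mu f t.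
Proof.
move=> t0; apply: mule_ge0; first by rewrite lee_fin invr_ge0.
by apply: integral_ge0 => x _; exact: rearrangement_ge0.
Qed.

Lemma integral_rearrangement_nondecreasing f (s t : R) : (s <= t)%R -> J f s <= J f t.
Proof.
move=> st; apply: ge0_subset_integral => //=.
- exact: measurable_rearrangement.
- by move=> x _; exact: rearrangement_ge0.
- by apply: subset_itvl; rewrite bnd_simp.
Qed.

Lemma max_rearrangementE f t : (0 < t)%R -> J f t = t%:E * max_rearrangement mu f t.
Proof.
by move=> t0; rewrite /max_rearrangement muleA -EFinM divff ?gt_eqF// mul1e.
Qed.

Lemma measurable_max_rearrangement f t :
  measurable_fun `]0%R, t[ (max_rearrangement mu f).
Proof.
apply: emeasurable_funM; last first.
  by apply: nondecreasing_emeasurable => // x y; exact: integral_rearrangement_nondecreasing.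
apply/measurable_EFinP.
apply: (eq_measurable_fun (fun x : R => x `^ (-1))%R).
  by move=> x; rewrite inE/= in_itv/= => /andP[x0 _]; rewrite powR_inv1// ltW.
exact: measurable_funTS (measurable_powR _).
Qed.

(** The right-hand side is the mean of the step function that takes on each
    dyadic interval the value of the rearrangement at its left end. *)
Lemma max_rearrangement_le_dyadic f t (B : R) : f \in Lfun mu p -> (0 < t)%R ->
  (forall m, \sum_(i < m) rearr mu f (t / 2 ^+ i.+1) / 2 ^+ i.+1 <= B)%R ->
  max_rearrangement mu f t <= B%:E.
Proof.
move=> fp t0 sB; rewrite -(@lee_pmul2l _ t%:E)// -max_rearrangementE//.
apply: (@integral_dyadic_le _ _ (fun j => rearr mu f (t / 2 ^+ j.+1))) => //.
- exact: measurable_rearrangement.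
- by move=> *; exact: rearrangement_ge0.
- move=> j z /andP[jz _]; rewrite (rearrE muT p1 fp) ?divr_gt0 ?exprn_gt0//.
  exact: rearrangement_nonincreasing.
move=> n; apply: (@le_trans _ _ (t * \sum_(i < n) rearr mu f (t / 2 ^+ i.+1) / 2 ^+ i.+1))%R.
  rewrite mulr_sumr ler_sum// => i _; rewrite le_eqVlt; apply/orP; left.
  by apply/eqP; ring.
by rewrite ler_pM2l.
Qed.

Lemma integral_rearrangement_double f t : f \in Lfun mu p -> (0 < t)%R ->
  J f (2 * t) <= J f t + (t * rearr mu f t)%:E.
Proof.
move=> fp t0.
have E : `]0%R, (2 * t)%R[%classic = `]0%R, t[ `|` `[t, (2 * t)%R[.
  apply/seteqP; split => x /=; rewrite !in_itv/=.
    move=> /andP[x0 xt]; case: (ltP x t) => h; first by left; rewrite x0.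
    by right; rewrite xt.
  move=> [/andP[-> xt]/=|/andP[tx ->]].
    by rewrite (lt_trans xt)// ltr_pMl// ltr1n.
  by rewrite (lt_le_trans t0).
rewrite /J E ge0_integral_setU//=; last 3 first.
- by rewrite -E; exact: measurable_rearrangement.
- by move=> x _; exact: rearrangement_ge0.
- apply/disj_setPS => x []/=; rewrite !in_itv/= => /andP[_ xt] /andP[tx _].
  by move: xt; rewrite ltNge tx.
rewrite leeD2l//.
apply: (@le_trans _ _ (\int[leb]_(z in `[t, (2 * t)%R[) (rearr mu f t)%:E)).
  apply: ge0_le_integral => //=.
  - by move=> x _; exact: rearrangement_ge0.
  - exact: measurable_rearrangement.
  move=> x; rewrite in_itv/= => /andP[tx _].
  by rewrite (rearrE muT p1 fp)//; exact: rearrangement_nonincreasing.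
rewrite integral_cst//= lebesgue_measure_itv/= lte_fin ifT; last by rewrite ltr_pMl// ltr1n.
by rewrite -EFinB -EFinM lee_fin; lra.
Qed.

(** Half of the mean over [(0, 2 t)] is the mean over [(0, t)]; on [[t, 2 t)] the
    rearrangement is at most its value at [t]. *)
Lemma max_rearrangement_double f t : f \in Lfun mu p -> (0 < t)%R ->
  max_rearrangement mu f (2 * t)
    <= (2^-1)%:E * (max_rearrangement mu f t + (rearr mu f t)%:E).
Proof.
move=> fp t0.
have t20 : (0 < 2 * t)%R by rewrite mulr_gt0.
rewrite -(@lee_pmul2l _ (2 * t)%:E)// -max_rearrangementE//.
apply: (le_trans (integral_rearrangement_double fp t0)).
rewrite muleA -EFinM mulrAC divff// mul1r ge0_muleDr ?lee_fin ?rearr_ge0//.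
  by rewrite -max_rearrangementE// EFinM.
exact/max_rearrangement_ge0/ltW.
Qed.

Lemma max_rearrangement_between f t0 j t : (0 < t0)%R ->
  (t0 / 2 ^+ j.+1 <= t < t0 / 2 ^+ j)%R ->
  max_rearrangement mu f t <= 2%:E * max_rearrangement mu f (t0 / 2 ^+ j).
Proof.
move=> t00 /andP[jt tj].
have h0 : (0 < t0 / 2 ^+ j.+1)%R by rewrite divr_gt0 ?exprn_gt0.
have t0' : (0 < t)%R by rewrite (lt_le_trans h0).
rewrite -(@lee_pmul2l _ t%:E)// -max_rearrangementE//.
apply: (le_trans (integral_rearrangement_nondecreasing f (ltW tj))).
rewrite max_rearrangementE; last exact: lt_trans tj.
rewrite [leRHS]muleA -EFinM lee_wpmul2r ?max_rearrangement_ge0//.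
  by rewrite ltW// (lt_trans t0').
rewrite lee_fin (_ : t0 / 2 ^+ j = t0 / 2 ^+ j.+1 * 2)%R ?ler_pM2r//.
by rewrite exprS; field; rewrite expf_neq0.
Qed.

End MaxRearrangement.

(** * A weighted Hardy inequality for the maximal rearrangement *)

Section WeightedHardy.
Context {R : realType} {d : measure_display} {T : measurableType d}.
Variable mu : {measure set T -> \bar R}.
Local Open Scope ereal_scope.
Notation leb := (@lebesgue_measure R).
Hypothesis muT : 0 < mu setT.

Lemma measurable_weighted (p t0 : R) (f : T -> R) (psi : R -> R) :
  measurable_fun `]0%R, t0[ psi ->
  measurable_fun `]0%R, t0[ (fun t =>
    ((psi t)%:E * max_rearrangement mu f t) `^ p * (t^-1)%:E).
Proof.
move=> mpsi; apply: emeasurable_funM.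
  apply: (measurableT_comp (measurable_poweR _)).
  apply: emeasurable_funM; first exact/measurable_EFinP.
  exact: measurable_max_rearrangement.
apply/measurable_EFinP.
apply: (eq_measurable_fun (fun x : R => x `^ (-1))%R).
  by move=> x; rewrite inE/= in_itv/= => /andP[x0 _]; rewrite powR_inv1// ltW.
exact: measurable_funTS (measurable_powR _).
Qed.

(** The sequence [w] discretizes the weight [psi].  The growth condition on [w] is
    the one of [hardy_averages]; it holds for powers [t `^ x] with [x < 1] and for
    [(1 + ln t^-1)^-1], the two weights of the theorem. *)
Lemma weighted_hardy (p r D : R) : (1 <= p)%R -> (0 < r < 1)%R -> (0 < D)%R ->
  exists2 C : R, (0 < C)%R & forall (f : T -> R) (t0 B : R) (w : nat -> R) (psi : R -> R),
    f \in Lfun mu p%:E -> (0 < t0)%R -> (0 <= B)%R ->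
    (forall j, 0 < w j)%R -> (forall j, w j <= 2 * r * w j.+1)%R ->
    (forall n, \sum_(j < n) (w j * rearr mu f (t0 / 2 ^+ j)) `^ p <= B `^ p)%R ->
    measurable_fun `]0%R, t0[ psi ->
    (forall t, (0 < t < t0)%R -> (0 <= psi t)%R) ->
    (forall j t, (t0 / 2 ^+ j.+1 <= t < t0 / 2 ^+ j)%R -> (psi t <= D * w j)%R) ->
    \int[leb]_(t in `]0%R, t0[)
      (((psi t)%:E * max_rearrangement mu f t) `^ p * (t^-1)%:E) <= (C * B `^ p)%:E.
Proof.
move=> p1 r01 D0; have [C0 C00 hardy] := hardy_averages p1 r01.
have p0 : (0 < p)%R by rewrite (lt_le_trans _ p1).
have p1' : 1 <= p%:E by rewrite lee_fin.
have /andP[r0 r1] := r01.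
exists ((D * 2) `^ p * C0)%R; first by rewrite mulr_gt0// powR_gt0// mulr_gt0.
move=> f t0 B w psi fp t00 B0 w0 wr wB mpsi psi0 psiw.
have tj j : (0 < t0 / 2 ^+ j)%R by rewrite divr_gt0// exprn_gt0.
pose a j := rearr mu f (t0 / 2 ^+ j).
have a0 j : (0 <= a j)%R by exact: rearr_ge0.
have wa0 j : (0 <= w j * a j)%R by rewrite mulr_ge0// ltW.
have aw j : (w j * a j <= B)%R.
  exact: (@le_of_sum_powR _ p (fun j => w j * a j)%R).
have Fle j b : (forall m, \sum_(i < m) a (j + i.+1)%N / 2 ^+ i.+1 <= b)%R ->
    max_rearrangement mu f (t0 / 2 ^+ j) <= b%:E.
  move=> ab; apply: (max_rearrangement_le_dyadic muT p1' fp) => // m.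
  apply: le_trans (ab m); rewrite le_eqVlt; apply/orP; left; apply/eqP.
  apply: eq_bigr => i _; congr (rearr _ _ _ / _)%R.
  by rewrite exprD invfM mulrA.
have F0 j : 0 <= max_rearrangement mu f (t0 / 2 ^+ j).
  by apply: max_rearrangement_ge0; rewrite ltW.
have Ffin j : max_rearrangement mu f (t0 / 2 ^+ j) \is a fin_num.
  rewrite ge0_fin_numE//; apply: (@le_lt_trans _ _ (B / (1 - r) / w j)%:E); last exact: ltry.
  by apply: Fle; exact: tail_average_le.
pose F j := fine (max_rearrangement mu f (t0 / 2 ^+ j)).
have FE j : (F j)%:E = max_rearrangement mu f (t0 / 2 ^+ j) by rewrite fineK.
have F0' j : (0 <= F j)%R by exact: fine_ge0.
have FB : forall n, (\sum_(j < n) (w j * F j) `^ p <= C0 * B `^ p)%R.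
  apply: (hardy w a F B) => //.
    move=> j; rewrite -lee_fin FE.
    have -> : (t0 / 2 ^+ j = 2 * (t0 / 2 ^+ j.+1))%R.
      by rewrite exprS; field; rewrite expf_neq0.
    apply: (le_trans (max_rearrangement_double muT p1' fp (tj _))).
    by rewrite -FE -EFinD -EFinM mulrC.
  by move=> n b ab; rewrite -lee_fin FE; exact: Fle.
apply: (@integral_dyadic_le _ _
  (fun j => (D * w j * (2 * F j)) `^ p / (t0 / 2 ^+ j.+1))%R) => //.
- exact: measurable_weighted.
- move=> t /andP[t1 _]; apply: mule_ge0; first exact: poweR_ge0.
  by rewrite lee_fin invr_ge0 ltW.
- move=> j t /[dup] jt /andP[jt1 jt2].
  have t1 : (0 < t)%R by rewrite (lt_le_trans (tj j.+1)).
  have tt0 : (t < t0)%R.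
    rewrite (lt_le_trans jt2)// ler_pdivrMr ?exprn_gt0// ler_peMr ?(ltW t00)//.
    by rewrite exprn_ege1// ler1n.
  have ps0 : (0 <= psi t)%R by apply: psi0; rewrite t1.
  rewrite EFinM; apply: lee_pmul => //.
  + exact: poweR_ge0.
  + by rewrite lee_fin invr_ge0 ltW.
  + rewrite -poweR_EFin; apply: gt0_ler_poweR; rewrite ?(ltW p0)//.
    * rewrite in_itv/= leey andbT mule_ge0 ?lee_fin// max_rearrangement_ge0//.
      exact: ltW.
    * by rewrite in_itv/= leey andbT lee_fin !mulr_ge0// ltW.
    rewrite EFinM; apply: lee_pmul; rewrite ?lee_fin//.
      by apply: max_rearrangement_ge0; exact: ltW.
      exact: psiw.
    rewrite EFinM FE; exact: max_rearrangement_between.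
  by rewrite lee_fin lef_pV2 ?posrE.
move=> n; rewrite -mulrA.
apply: (@le_trans _ _ ((D * 2) `^ p * \sum_(j < n) (w j * F j) `^ p)%R).
  rewrite mulr_sumr ler_sum// => j _.
  rewrite mulrCA divff ?mulr1 ?gt_eqF// -powRM ?mulr_ge0 ?(ltW D0) ?(ltW (w0 _))//.
  by rewrite le_eqVlt; apply/orP; left; apply/eqP; congr (_ `^ p)%R; ring.
by rewrite ler_wpM2l ?powR_ge0.
Qed.

End WeightedHardy.

(** * The subcritical case *)

Section Subcritical.
Context {R : realType} {d : measure_display} {T : measurableType d}.
Variable mu : {measure set T -> \bar R}.
Local Open Scope ereal_scope.
Notation leb := (@lebesgue_measure R).
Hypothesis muT : 0 < mu setT.

(** Apart from integrability, the only information on [g] used from here on. *)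
Definition oscillation_bound (sg K : R) (f g : T -> R) :=
  forall z t : R, (0 < z)%R -> (0 < t)%R ->
  (rearr mu f z <= rearr mu f t +
    K * t `^ sg * (rearr mu g z + rearr mu g t))%R.

Lemma oscillation_half (sg K t : R) p f g : (0 <= K)%R -> 1 <= p ->
  g \in Lfun mu p -> oscillation_bound sg K f g -> (0 < t)%R ->
  (rearr mu f (t / 2) <= rearr mu f t + 2 * K * t `^ sg * rearr mu g (t / 2))%R.
Proof.
move=> K0 p1 gp osc t0; have t20 : (0 < t / 2)%R by rewrite divr_gt0.
apply: (le_trans (osc _ _ t20 t0)); rewrite lerD2l.
have gg : (rearr mu g t <= rearr mu g (t / 2))%R.
  by apply: (le_rearr muT p1 gp) => //; lra.
have -> : (2 * K * t `^ sg * rearr mu g (t / 2) =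
  K * t `^ sg * (rearr mu g (t / 2) + rearr mu g (t / 2)))%R by ring.
by rewrite ler_wpM2l ?mulr_ge0 ?powR_ge0// lerD2l.
Qed.

Lemma sum_powR_rearr (p k : R) g (t0 : R) n : (1 <= p)%R -> (0 <= k)%R ->
  g \in Lfun mu p%:E -> (0 < t0)%R ->
  (\sum_(j < n) (k * ((t0 / 2 ^+ j.+1) `^ p^-1 * rearr mu g (t0 / 2 ^+ j.+1))) `^ p
    <= k `^ p * (2 * 2 `^ p * fine 'N[mu]_p%:E[EFin \o g] `^ p))%R.
Proof.
move=> p1 k0 gp t00; have p0 : (0 < p)%R by rewrite (lt_le_trans _ p1).
have := sum_rearr_powR_le_Lnorm n.+1 muT p1 gp t00.
have tj j : (0 < t0 / 2 ^+ j)%R by rewrite divr_gt0// exprn_gt0.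
rewrite big_ord_recl/= => h.
apply: (@le_trans _ _
  (k `^ p * \sum_(j < n) t0 / 2 ^+ j.+1 * rearr mu g (t0 / 2 ^+ j.+1) `^ p)%R).
  rewrite mulr_sumr ler_sum// => j _.
  move: (t0 / 2 ^+ j.+1)%R (tj j.+1) => u u0.
  rewrite !powRM ?mulr_ge0 ?powR_ge0 ?rearr_ge0//.
  by rewrite -powRrM mulVf ?gt_eqF// powRr1// ltW.
rewrite ler_wpM2l ?powR_ge0//; apply: le_trans h.
by rewrite lerDr mulr_ge0 ?powR_ge0// ltW.
Qed.

Lemma powR_half (t x : R) : (0 <= t)%R -> (t `^ x = 2 `^ x * (t / 2) `^ x)%R.
Proof. by move=> t0; rewrite -powRM ?divr_ge0// mulrCA divff ?mulr1. Qed.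

Lemma powR2_gt1 (x : R) : (0 < x)%R -> (1 < 2 `^ x :> R)%R.
Proof.
move=> x0; have : (1 `^ x < 2 `^ x :> R)%R.
  by apply: gt0_ltr_powR; rewrite ?nnegrE// ltr1n.
by rewrite powR1.
Qed.

(** With [th = p^-1 - sg], the sequence [t_j `^ th * f^*(t_j)] contracts by [2 `^ (- th)]
    up to the error [t_j `^ p^-1 * g^*(t_j)], which is summable to the power [p].
    The initial term is handled by the weak-type bound for [f]; it produces the
    summand with [t0 `^ (- sg)]. *)
Lemma subcritical_bound (p sg K : R) : (1 <= p)%R -> (0 < sg)%R -> (sg < p^-1)%R ->
  (0 <= K)%R ->
  exists2 C : R, (0 < C)%R & forall f g : T -> R,
    f \in Lfun mu p%:E -> g \in Lfun mu p%:E -> oscillation_bound sg K f g ->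
    forall t0 : R, (0 < t0)%R ->
    \int[leb]_(t in `]0%R, t0[)
      (((t `^ (p^-1 - sg))%:E * max_rearrangement mu f t) `^ p * (t^-1)%:E) <=
    (C * (fine 'N[mu]_p%:E[EFin \o g] + t0 `^ (- sg) * fine 'N[mu]_p%:E[EFin \o f]) `^ p)%:E.
Proof.
move=> p1 sg0 sgp K0; have p0 : (0 < p)%R by rewrite (lt_le_trans _ p1).
have p1' : 1 <= p%:E by rewrite lee_fin.
pose th := (p^-1 - sg)%R.
have th0 : (0 < th)%R by rewrite subr_gt0.
have th1 : (th < 1)%R.
  have : (p^-1 <= 1)%R by rewrite invf_le1.
  rewrite /th; lra.
pose r := (2 `^ (- th))%R.
have r01 : (0 < r < 1)%R.
  rewrite powR_gt0//= /r powRN invf_lt1 ?powR_gt0//.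
  exact: powR2_gt1.
have /andP[r0 r1] := r01.
pose r' := (2 `^ (th - 1))%R.
have r'01 : (0 < r' < 1)%R.
  rewrite powR_gt0//= /r' -[(th - 1)%R]opprB powRN invf_lt1 ?powR_gt0//.
  by rewrite powR2_gt1// subr_gt0.
have [C0 C00 hardy] := weighted_hardy muT p1 r'01 (@ltr01 R).
pose k := (2 * K * 2 `^ sg)%R.
have k0 : (0 <= k)%R by rewrite !mulr_ge0// powR_ge0.
pose D := ((1 - r) `^ (1 - p))%R.
have D0 : (0 <= D)%R by exact: powR_ge0.
pose E := (D * (k `^ p * (2 * 2 `^ p)) + 4 `^ p)%R.
have E0 : (0 < E)%R by rewrite ltr_wpDl ?powR_gt0// !mulr_ge0// powR_ge0.
exists (C0 * ((1 - r)^-1 * E))%R.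
  by rewrite !mulr_gt0// invr_gt0 subr_gt0.
move=> f g fp gp osc t0 t00.
set M := fine 'N[mu]_p%:E[EFin \o g]; set Mf := fine 'N[mu]_p%:E[EFin \o f].
have M0 : (0 <= M)%R by exact/fine_ge0/Lnorm_ge0.
have Mf0 : (0 <= Mf)%R by exact/fine_ge0/Lnorm_ge0.
set S := (M + t0 `^ (- sg) * Mf)%R.
have tM0 : (0 <= t0 `^ (- sg) * Mf)%R by rewrite mulr_ge0// powR_ge0.
have S0 : (0 <= S)%R by rewrite addr_ge0.
have tj j : (0 < t0 / 2 ^+ j)%R by rewrite divr_gt0// exprn_gt0.
have tS j : (t0 / 2 ^+ j.+1 = (t0 / 2 ^+ j) / 2)%R by exact: dyadic_half.
pose w j := ((t0 / 2 ^+ j) `^ th)%R.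
pose x j := (w j * rearr mu f (t0 / 2 ^+ j))%R.
pose y j := (k * ((t0 / 2 ^+ j) `^ p^-1 * rearr mu g (t0 / 2 ^+ j)))%R.
have x0 j : (0 <= x j)%R by rewrite mulr_ge0 ?powR_ge0 ?rearr_ge0.
have y0 j : (0 <= y j)%R by rewrite !mulr_ge0 ?powR_ge0 ?rearr_ge0.
have wS j : (w j = 2 `^ th * w j.+1)%R.
  by rewrite /w tS powR_half// ltW.
have xy j : (x j.+1 <= r * x j + y j.+1)%R.
  rewrite /x.
  have -> : (r * (w j * rearr mu f (t0 / 2 ^+ j)) = w j.+1 * rearr mu f (t0 / 2 ^+ j))%R.
    by rewrite wS mulrA mulrA /r powRN mulVf ?mul1r// gt_eqF// powR_gt0.
  have -> : (y j.+1 = w j.+1 * (2 * K * (t0 / 2 ^+ j) `^ sg * rearr mu g (t0 / 2 ^+ j.+1)))%R.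
    rewrite /y /k /w [((t0 / 2 ^+ j) `^ sg)%R]powR_half ?(ltW (tj _))// -tS.
    have -> : p^-1%R = (th + sg)%R by rewrite /th subrK.
    rewrite powRD; last by rewrite gt_eqF ?implybT// addr_gt0.
    ring.
  rewrite -mulrDr ler_wpM2l ?powR_ge0// tS.
  exact: (oscillation_half K0 p1' gp osc (tj j)).
have X j : (x j.+1 `^ p <= r * x j `^ p + D * y j.+1 `^ p)%R by exact: powR_absorb.
have x0S : (x 0%N <= 4 * (t0 `^ (- sg) * Mf))%R.
  rewrite /x /w expr0 divr1 /th powRD; last by rewrite gt_eqF// implybT.
  have := rearr_weak_type muT p1' fp t00; rewrite inver gt_eqF//= => h.
  have -> : (t0 `^ p^-1 * t0 `^ (- sg) * rearr mu f t0 =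
    t0 `^ (- sg) * (t0 `^ p^-1 * rearr mu f t0))%R by ring.
  have -> : (4 * (t0 `^ (- sg) * Mf) = t0 `^ (- sg) * (4 * Mf))%R by ring.
  by rewrite ler_wpM2l ?powR_ge0.
have sumx n : (\sum_(j < n) x j `^ p <= (1 - r)^-1 * E * S `^ p)%R.
  have := sum_absorb_forward (Y := fun j => D * y j `^ p)%R n X.
  rewrite -mulr_sumr => h.
  rewrite -mulrA ler_pdivlMl ?subr_gt0//.
  apply: (@le_trans _ _ (x 0%N `^ p + D * \sum_(j < n) y j.+1 `^ p)%R).
    by apply: le_trans h; rewrite lerDl powR_ge0.
  rewrite /E mulrDl addrC lerD//.
    rewrite -mulrA ler_wpM2l//.
    apply: (le_trans (sum_powR_rearr n p1 k0 gp t00)).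
    rewrite -[leRHS]mulrA ler_wpM2l ?powR_ge0// ler_wpM2l ?mulr_ge0 ?powR_ge0//.
    by apply: ge0_ler_powR; rewrite ?nnegrE ?(ltW p0)// lerDl.
  rewrite -powRM//; apply: ge0_ler_powR; rewrite ?nnegrE ?(ltW p0)//.
    by rewrite mulr_ge0.
  by apply: (le_trans x0S); rewrite ler_pM2l// lerDr.
pose B := (((1 - r)^-1 * E) `^ p^-1 * S)%R.
have BE : (B `^ p = (1 - r)^-1 * E * S `^ p)%R.
  rewrite powRM ?powR_ge0// -powRrM mulVf ?gt_eqF// powRr1//.
  by rewrite mulr_ge0 ?(ltW E0)// invr_ge0 subr_ge0 ltW.
rewrite -[(C0 * _ * _)%R]mulrA -BE.
apply: (hardy f t0 B w) => //.
- by rewrite mulr_ge0// powR_ge0.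
- by move=> j; exact: powR_gt0.
- move=> j; rewrite wS le_eqVlt; apply/orP; left; apply/eqP; congr (_ * _)%R.
  rewrite /r' (@powRB _ 2 th 1%R); last by rewrite pnatr_eq0 implybT.
  by rewrite powRr1// mulrCA divff ?mulr1.
- by move=> n; rewrite BE.
- exact: measurable_funTS (measurable_powR _).
- by move=> t _; exact: powR_ge0.
move=> j t /andP[jt tj']; rewrite mul1r.
apply: ge0_ler_powR; rewrite ?nnegrE ?(ltW th0) ?(ltW (tj _)) ?(ltW tj')//.
by rewrite (le_trans _ jt)// ltW.
Qed.

End Subcritical.

(** * The Lorentz norm and the critical case *)

Section LorentzAndCritical.
Context {R : realType} {d : measure_display} {T : measurableType d}.
Variable mu : {measure set T -> \bar R}.
Local Open Scope ereal_scope.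
Notation leb := (@lebesgue_measure R).
Hypothesis muT : 0 < mu setT.

(** Let [t0] tend to infinity in [subcritical_bound].  As the norm of [f] enters
    with the factor [t0 `^ (- sg)], it drops out of the limit. *)
Lemma lorentz_subcritical (p q sg K : R) : (1 <= p)%R -> (0 < sg)%R -> (sg < p^-1)%R ->
  (q^-1 = p^-1 - sg)%R -> (0 <= K)%R ->
  exists2 C : R, (0 < C)%R & forall f g : T -> R,
    f \in Lfun mu p%:E -> g \in Lfun mu p%:E -> oscillation_bound mu sg K f g ->
    lorentz_norm mu q p f <= C%:E * 'N[mu]_p%:E[EFin \o g].
Proof.
move=> p1 sg0 sgp qE K0; have p0 : (0 < p)%R by rewrite (lt_le_trans _ p1).
have [C C0 dyadic] := subcritical_bound muT p1 sg0 sgp K0.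
exists (C `^ p^-1)%R; first exact: powR_gt0.
move=> f g fp gp osc; rewrite /lorentz_norm qE.
rewrite -[X in _ <= _ * X]fineK ?Lfun_Lnorm_fin//.
set M := fine 'N[mu]_p%:E[EFin \o g]; pose Mf := fine 'N[mu]_p%:E[EFin \o f].
have M0 : (0 <= M)%R by exact/fine_ge0/Lnorm_ge0.
have Mf0 : (0 <= Mf)%R by exact/fine_ge0/Lnorm_ge0.
pose Phi (t : R) := ((t `^ (p^-1 - sg))%:E * max_rearrangement mu f t) `^ p * (t^-1)%:E.
rewrite -[X in X `^ _ <= _]/(\int[leb]_(t in `]0%R, +oo[) Phi t).
have Phi0 t : (0 < t)%R -> 0 <= Phi t.
  move=> t0; apply: mule_ge0; first exact: poweR_ge0.
  by rewrite lee_fin invr_ge0 ltW.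
pose G (n : nat) := `]0%R, (2 ^+ n)%R[%classic : set R.
have ndG : nondecreasing_seq G.
  apply/nondecreasing_seqP => n; apply/subsetPset => t; rewrite /G /= !in_itv/=.
  by move=> /andP[-> tn]; rewrite (lt_le_trans tn)// ler_eXn2l// ltr1n.
have mG n : measurable (G n) by exact: measurable_itv.
have mPhi n : measurable_fun (G n) Phi.
  by apply: measurable_weighted; exact: measurable_funTS (measurable_powR _).
have GPhi n t : G n t -> 0 <= Phi t.
  by rewrite /G/= in_itv/= => /andP[t0 _]; exact: Phi0.
have bigG : \bigcup_n G n = `]0%R, +oo[%classic.
  apply/seteqP; split => [t [n _]|t]; rewrite /G /= !in_itv/= andbT.
    by move=> /andP[].
  move=> t0; exists (Num.Def.archi_bound t) => //=.
  by rewrite in_itv/= t0/=; exact: upper_nthrootP.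
have bound e : (0 < e)%R -> \int[leb]_(t in `]0%R, +oo[) Phi t <= (C * (M + e) `^ p)%:E.
  move=> e0.
  have : \int[leb]_(x in G i) Phi x @[i --> \oo] -->
      \int[leb]_(x in \bigcup_i G i) Phi x.
    exact: ge0_nondecreasing_set_cvg_integral.
  rewrite bigG => /cvg_lim <-//.
  apply: lime_le.
    apply: ereal_nondecreasing_is_cvgn.
    exact: ge0_nondecreasing_set_nondecreasing_integral.
  apply: nearW => n.
  (* The integral over []0, 2 ^+ n[[ is bounded through a larger interval, for which
   the term involving [f] is at most [e]. *)
  pose m := maxn n (Num.Def.archi_bound ((Mf / e) `^ sg^-1)%R).
  have m0 : (0 < 2 ^+ m :> R)%R by rewrite exprn_gt0.
  apply: (@le_trans _ _ (\int[leb]_(x in G m) Phi x)).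
    apply: ge0_subset_integral; [exact: mG|exact: mG|exact: mPhi|exact: GPhi|].
    by apply/subsetPset/ndG; exact: leq_maxl.
  apply: (le_trans (dyadic f g fp gp osc _ m0)); rewrite lee_fin ler_pM2l//.
  apply: ge0_ler_powR; rewrite ?nnegrE ?(ltW p0)// ?addr_ge0 ?mulr_ge0 ?powR_ge0 ?(ltW e0)//.
  rewrite lerD2l powRN mulrC ler_pdivrMr ?powR_gt0// -ler_pdivrMl// mulrC.
  have h : ((Mf / e) `^ sg^-1 <= 2 ^+ m)%R by apply/ltW/upper_nthrootP; exact: leq_maxr.
  have Mfe0 : (0 <= Mf / e)%R by rewrite divr_ge0// ltW.
  have := ge0_ler_powR (ltW sg0) _ _ h; rewrite !nnegrE powR_ge0 (ltW m0) => /(_ isT isT).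
  by rewrite -powRrM mulVf ?gt_eqF// powRr1.
apply/lee_addgt0Pr => e e0.
have Cp0 : (0 < C `^ p^-1)%R by exact: powR_gt0.
have eC : (0 < e / C `^ p^-1)%R by rewrite divr_gt0.
apply: (@le_trans _ _ ((C * (M + e / C `^ p^-1) `^ p)%:E `^ p^-1)).
  apply: gt0_ler_poweR; last exact: bound.
  - by rewrite invr_ge0 ltW.
  - rewrite in_itv/= leey andbT; apply: integral_ge0 => t /=.
    by rewrite in_itv/= andbT; exact: Phi0.
  - by rewrite in_itv/= leey andbT lee_fin mulr_ge0 ?powR_ge0// ltW.
have Me0 : (0 <= M + e / C `^ p^-1)%R by rewrite addr_ge0// ltW.
rewrite poweR_EFin powRM ?powR_ge0// ?(ltW C0)// -powRrM mulfV ?gt_eqF// powRr1//.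
by rewrite mulrDr mulrCA divff ?gt_eqF// mulr1 EFinD EFinM.
Qed.

(** Here the recursion for [f^*(2^-j)] does not contract, but its increments are
    summable to the power [p], and [hardy_discrete] applies as [p > 1].  The
    weight satisfies [1 + ln t^-1 >= (j + 2) / 2] on the [j]-th dyadic interval. *)
Lemma log_critical (p K : R) : (1 < p)%R -> (0 <= K)%R ->
  exists2 C : R, (0 < C)%R & forall f g : T -> R,
    f \in Lfun mu p%:E -> g \in Lfun mu p%:E -> oscillation_bound mu p^-1 K f g ->
    (\int[leb]_(t in `]0%R, 1%R[)
       ((max_rearrangement mu f t * ((1 + ln (t^-1))^-1)%:E) `^ p * (t^-1)%:E)) `^ p^-1
    <= C%:E * ('N[mu]_p%:E[EFin \o g] + (rearr mu f 1)%:E).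
Proof.
move=> p1 K0; have p0 : (0 < p)%R by rewrite (lt_trans _ p1).
have p1' : 1 <= p%:E by rewrite lee_fin ltW.
have r01 : (0 < (3 / 4 : R) < 1)%R by lra.
(* With weights [j.+2^-1], the ratio of consecutive weights is at most [3 / 2]. *)
have [C0 C00 hardy] := weighted_hardy muT (ltW p1) r01 (@ltr0Sn R 1).
have [C1 C10 hardy1] := @hardy_discrete R p p1.
pose k := (2 * K * 2 `^ p^-1)%R.
have k0 : (0 <= k)%R by rewrite !mulr_ge0// powR_ge0.
pose E := (C1 * (1 + k `^ p * (2 * 2 `^ p)))%R.
have E0 : (0 < E)%R by rewrite mulr_gt0// ltr_pwDl// !mulr_ge0// powR_ge0.
exists ((C0 * E) `^ p^-1)%R; first by rewrite powR_gt0// mulr_gt0.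
move=> f g fp gp osc.
rewrite -['N[mu]_p%:E[_]]fineK ?Lfun_Lnorm_fin//.
set M := fine 'N[mu]_p%:E[EFin \o g].
have M0 : (0 <= M)%R by exact/fine_ge0/Lnorm_ge0.
set A := rearr mu f 1; have A0 : (0 <= A)%R by exact: rearr_ge0.
pose a j := rearr mu f (1 / 2 ^+ j).
pose b j := (k * ((1 / 2 ^+ j) `^ p^-1 * rearr mu g (1 / 2 ^+ j)))%R.
have a0 j : (0 <= a j)%R by exact: rearr_ge0.
have b0 j : (0 <= b j)%R by rewrite !mulr_ge0 ?powR_ge0 ?rearr_ge0.
have tj j : (0 < 1 / 2 ^+ j :> R)%R by rewrite divr_gt0// exprn_gt0.
have tS j : (1 / 2 ^+ j.+1 = (1 / 2 ^+ j) / 2 :> R)%R by exact: dyadic_half.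
have ab j : (a j.+1 <= a j + b j.+1)%R.
  rewrite /a /b; apply: le_trans
    (_ : _ <= _ + 2 * K * (1 / 2 ^+ j) `^ p^-1 * rearr mu g (1 / 2 ^+ j.+1))%R _.
    by rewrite tS; exact: (oscillation_half muT K0 p1' gp osc (tj j)).
  rewrite lerD2l [((1 / 2 ^+ j) `^ _)%R]powR_half ?(ltW (tj _))// -tS /k.
  by rewrite le_eqVlt; apply/orP; left; apply/eqP; ring.
have AM0 : (0 <= M + A)%R by rewrite addr_ge0.
have suma n : (\sum_(j < n) (a j / j.+1%:R) `^ p <= E * (M + A) `^ p)%R.
  apply: (le_trans (hardy1 a b n a0 b0 ab)).
  rewrite -mulrA ler_wpM2l ?(ltW C10)// mulrDl mul1r lerD//.
    rewrite /a expr0 divr1; apply: ge0_ler_powR; rewrite ?nnegrE ?(ltW p0)//.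
    by rewrite lerDr.
  apply: (le_trans (sum_powR_rearr muT n (ltW p1) k0 gp ltr01)).
  rewrite -[leRHS]mulrA ler_wpM2l ?powR_ge0// ler_wpM2l ?mulr_ge0 ?powR_ge0//.
  by apply: ge0_ler_powR; rewrite ?nnegrE ?(ltW p0)// lerDl.
pose B := (E `^ p^-1 * (M + A))%R.
have BE : (B `^ p = E * (M + A) `^ p)%R.
  by rewrite powRM ?powR_ge0// -powRrM mulVf ?gt_eqF// powRr1// ltW.
pose w (j : nat) := (j.+2%:R^-1 : R)%R.
have w0 j : (0 < w j)%R by rewrite invr_gt0.
have lnge (t : R) (j : nat) : (t < 1 / 2 ^+ j)%R -> (0 < t)%R -> (j.+2%:R / 2 <= 1 + ln t^-1)%R.
  move=> tlt t0.
  (* Evaluate [ln (1 + x) <= x] at [x = - 2^-1]. *)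
  have ln2 : (2^-1 <= ln 2 :> R)%R.
    have := @le_ln1Dx R (- 2^-1)%R; rewrite (_ : 1 + - 2^-1 = 2^-1)%R; last by field.
    rewrite lnV ?posrE// lerN2; apply; lra.
  have : (ln (2 ^+ j) <= ln t^-1 :> R)%R.
    rewrite ler_ln ?posrE ?invr_gt0 ?exprn_gt0//.
    rewrite -[leLHS]invrK lef_pV2 ?posrE ?invr_gt0 ?exprn_gt0//.
    by rewrite -div1r ltW.
  have -> : (ln (2 ^+ j) = j%:R * ln 2 :> R)%R by rewrite lnXn// mulr_natl.
  have j0 : (0 <= j%:R :> R)%R by [].
  move=> h; have := ler_wpM2l j0 ln2.
  rewrite -[j.+2]addn2 natrD; lra.
have mlog : measurable_fun (`]0%R, 1%R[%classic : set R) (fun t : R => (1 + ln t^-1)^-1)%R.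
  apply: (eq_measurable_fun (fun t : R => (1 - ln t) `^ (-1))%R).
    move=> t; rewrite inE/= in_itv/= => /andP[t0 t1].
    have lnt : (ln t <= 0)%R by rewrite ln_le0// ltW.
    by rewrite powR_inv1 ?lnV ?posrE//; lra.
  apply: measurable_funTS; apply: (measurableT_comp (measurable_powR _)).
  by apply: measurable_funB => //; exact: measurable_ln.
have psi0 (t : R) : (0 < t < 1)%R -> (0 <= (1 + ln t^-1)^-1)%R.
  move=> /andP[t0 t1]; rewrite invr_ge0 lnV ?posrE//.
  have lnt : (ln t <= 0)%R by rewrite ln_le0// ltW.
  lra.
have := hardy f 1%R B w (fun t => (1 + ln t^-1)^-1)%R fp ltr01.
have B0 : (0 <= B)%R by rewrite mulr_ge0// powR_ge0.
move=> /(_ B0 w0) {}hardy.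
have Phi0 (t : R) : (0 < t < 1)%R ->
    0 <= (max_rearrangement mu f t * ((1 + ln t^-1)^-1)%:E) `^ p * (t^-1)%:E.
  move=> /andP[t0 _]; apply: mule_ge0; first exact: poweR_ge0.
  by rewrite lee_fin invr_ge0 ltW.
have : \int[leb]_(t in `]0%R, 1%R[)
    ((max_rearrangement mu f t * ((1 + ln t^-1)^-1)%:E) `^ p * (t^-1)%:E) <= (C0 * B `^ p)%:E.
  under eq_integral do rewrite [_ * ((1 + _)^-1)%:E]muleC.
  apply: hardy => //.
  - move=> j; rewrite /w.
    have j2 : (0 < j.+2%:R :> R)%R by [].
    have j3 : (0 < j.+3%:R :> R)%R by [].
    rewrite -[leLHS]mul1r ler_pdivrMr// mulrAC ler_pdivlMr//.
    have : (2 <= j.+2%:R :> R)%R by rewrite ler_nat.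
    rewrite -[j.+3]addn1 natrD; lra.
  - move=> n; rewrite BE; apply: le_trans (suma n).
    apply: ler_sum => j _; apply: ge0_ler_powR;
      rewrite ?nnegrE ?(ltW p0) ?mulr_ge0 ?divr_ge0 ?(ltW (w0 _))//.
      exact: a0.
    by rewrite mulrC /w ler_wpM2l ?rearr_ge0// lef_pV2 ?posrE// ler_nat.
  - move=> j t /andP[jt tj'].
    have t0 : (0 < t)%R by rewrite (lt_le_trans _ jt).
    have h := lnge t j tj' t0.
    have -> : (2 * w j = (j.+2%:R / 2)^-1)%R by rewrite /w invf_div.
    rewrite lef_pV2 ?posrE// ?(lt_le_trans _ h)//; by rewrite divr_gt0.
move=> hint.
apply: (@le_trans _ _ ((C0 * B `^ p)%:E `^ p^-1)).
  apply: gt0_ler_poweR => //.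
  - by rewrite invr_ge0 ltW.
  - rewrite in_itv/= leey andbT; apply: integral_ge0 => t /=.
    by rewrite in_itv/=; exact: Phi0.
  - by rewrite in_itv/= leey andbT lee_fin mulr_ge0 ?powR_ge0// ltW.
have CE0 : (0 <= C0 * E)%R by apply: mulr_ge0; exact: ltW.
rewrite poweR_EFin BE mulrA powRM ?powR_ge0//.
by rewrite -(powRrM _ p) mulfV ?gt_eqF// powRr1// EFinM EFinD.
Qed.

End LorentzAndCritical.

(** * The supercritical case and the case of weak type *)

Section SupercriticalAndWeak.
Context {R : realType} {d : measure_display} {T : measurableType d}.
Variable mu : {measure set T -> \bar R}.
Local Open Scope ereal_scope.
Notation leb := (@lebesgue_measure R).
Hypothesis muT : 0 < mu setT.

Lemma powR_dyadic (x : R) (j : nat) : ((1 / 2 ^+ j) `^ x = (2 `^ (- x)) ^+ j)%R.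
Proof.
rewrite -powR_mulrn ?powR_ge0// -powRrM.
have -> : (- x * j%:R = - j%:R * x)%R by ring.
by rewrite powRrM powR_invn// div1r.
Qed.

(** The essential supremum is the limit of the rearrangement at 0. *)
Lemma Linfty_le_of_rearr p f (B : R) : 1 <= p -> f \in Lfun mu p ->
  (forall n : nat, (rearr mu f (1 / 2 ^+ n) <= B)%R) ->
  'N[mu]_+oo[EFin \o f] <= B%:E.
Proof.
move=> p1 fp fB; have mf := Lfun_measurable fp.
have tj (j : nat) : (0 < 1 / 2 ^+ j :> R)%R by rewrite divr_gt0// exprn_gt0.
rewrite unlock muT; apply/lee_addgt0Pr => e e0; apply/ess_supP.
exists [set x | (B + e < `|f x|)%R]; split.
- exact: measurable_superlevel.
- apply/eqP; rewrite eq_le measure_ge0 andbT; apply/lee_addgt0Pr => e' e'0.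
  pose n := Num.Def.archi_bound (e'^-1)%R.
  rewrite add0e; apply: (@le_trans _ _ (1 / 2 ^+ n)%:E).
    apply: rearrangement_lt => //; rewrite -(rearrE muT p1 fp)// lte_fin.
    by rewrite (le_lt_trans (fB n))// ltrDl.
  rewrite lee_fin div1r -[leRHS]invrK lef_pV2 ?posrE ?invr_gt0 ?exprn_gt0//.
  exact/ltW/upper_nthrootP.
by move=> x /= /negP; rewrite -ltNge -EFinD lte_fin.
Qed.

(** The weak-type bound for [g] makes the increments of [f^*(2^-j)] decay like
    [2^(- j (sg - 1/p))]. *)
Lemma Linfty_supercritical p (sg K : R) : 1 <= p -> (fine p^-1 < sg)%R -> (0 <= K)%R ->
  exists2 C : R, (0 < C)%R & forall f g : T -> R,
    f \in Lfun mu p -> g \in Lfun mu p -> oscillation_bound mu sg K f g ->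
    'N[mu]_+oo[EFin \o f] <= C%:E * ('N[mu]_p[EFin \o g] + (rearr mu f 1)%:E).
Proof.
move=> p1 psg K0; set u := fine p^-1 in psg *.
pose r := (2 `^ (- (sg - u)))%R.
have r0 : (0 < r)%R by exact: powR_gt0.
have r1 : (r < 1)%R by rewrite /r powRN invf_lt1 ?powR_gt0// powR2_gt1// subr_gt0.
pose k := (2 * K * 2 `^ sg * 4)%R.
have k0 : (0 <= k)%R by rewrite !mulr_ge0// powR_ge0.
have kr0 : (0 <= k / (1 - r))%R by rewrite divr_ge0// subr_ge0 ltW.
exists (1 + k / (1 - r))%R; first by rewrite ltr_pwDl.
move=> f g fp gp osc.
rewrite -['N[mu]_p[_]]fineK ?Lfun_Lnorm_fin//.
set M := fine 'N[mu]_p[EFin \o g]; set A := rearr mu f 1.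
have M0 : (0 <= M)%R by exact/fine_ge0/Lnorm_ge0.
have A0 : (0 <= A)%R by exact: rearr_ge0.
have tj (j : nat) : (0 < 1 / 2 ^+ j :> R)%R by rewrite divr_gt0// exprn_gt0.
have tS (j : nat) : (1 / 2 ^+ j.+1 = (1 / 2 ^+ j) / 2 :> R)%R by exact: dyadic_half.
have step (j : nat) :
    (rearr mu f (1 / 2 ^+ j.+1) <= rearr mu f (1 / 2 ^+ j) + k * M * r ^+ j)%R.
  rewrite [X in (rearr _ _ X <= _)%R]tS.
  apply: (le_trans (oscillation_half muT K0 p1 gp osc (tj j))); rewrite lerD2l -tS.
  rewrite [((1 / 2 ^+ j) `^ _)%R]powR_half ?(ltW (tj _))// -tS.
  have := rearr_weak_type muT p1 gp (tj j.+1); rewrite -/u -/M => h.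
  have tE : ((1 / 2 ^+ j.+1) `^ sg = r ^+ j.+1 * (1 / 2 ^+ j.+1) `^ u)%R.
    rewrite /r -powR_dyadic -powRD ?subrK//.
    by rewrite (gt_eqF (tj _)) implybT.
  rewrite tE; apply: (@le_trans _ _ (2 * K * 2 `^ sg * r ^+ j.+1 * (4 * M)))%R.
    rewrite [leLHS](_ : _ = 2 * K * 2 `^ sg * r ^+ j.+1 *
      ((1 / 2 ^+ j.+1) `^ u * rearr mu g (1 / 2 ^+ j.+1)))%R; last by ring.
    by rewrite ler_wpM2l// !mulr_ge0 ?powR_ge0// exprn_ge0// ltW.
  rewrite [leLHS](_ : _ = k * M * r ^+ j.+1)%R; last by rewrite /k; ring.
  rewrite ler_wpM2l ?mulr_ge0// exprS ler_piMl ?exprn_ge0// ltW//.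
apply: (@le_trans _ _ (A + k * M / (1 - r))%:E).
  apply: (Linfty_le_of_rearr p1 fp) => n.
  have := @bounded_of_geometric_increments R r (k * M)%R (fun j => rearr mu f (1 / 2 ^+ j)) n.
  rewrite expr0 divr1; apply => //; first by rewrite (ltW r0).
  exact: mulr_ge0.
rewrite -EFinD -EFinM lee_fin.
have -> : (k * M / (1 - r) = k / (1 - r) * M)%R by ring.
have := mulr_ge0 kr0 A0; move: (k / (1 - r))%R => c' cA.
rewrite [leRHS](_ : _ = M + A + c' * M + c' * A)%R; last by ring.
lra.
Qed.

(** If [f = h1 + h2], then [|f|] can exceed [h1^*(1) + |h2|_oo] only where [|h1|]
    exceeds [h1^*(1)] or on a null set, and [h1^*(1) <= 4 |h1|_1]. *)
Lemma rearr1_le_sum_norm p f : 1 <= p -> f \in Lfun mu p ->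
  (rearr mu f 1)%:E <= 4%:E * sum_L1_Linfty_norm mu f.
Proof.
move=> p1 fp; rewrite -lee_pdivrMl// -EFinM.
apply: le_ereal_inf_tmp => _ [[h1 h2] /= [h1p h2p fh] <-].
have n1 := Lfun_Lnorm_fin h1p; have n2 := Lfun_Lnorm_fin h2p.
rewrite -(fineK n1) -(fineK n2) -EFinD lee_fin.
have w1 := rearr_weak_type muT (lexx 1) h1p (@ltr01 R).
rewrite powR1 mul1r in w1.
have h20 := rearrangement_le_Linfty muT h2p (lexx 0%R).
move: w1 h20; rewrite -(fineK n2).
have N2 : (0 <= fine 'N[mu]_+oo[EFin \o h2])%R by exact/fine_ge0/Lnorm_ge0.
move: (fine 'N[mu]_+oo[EFin \o h2]) N2 (fine 'N[mu]_1[EFin \o h1]) => N2 N20 N1 w1 h20.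
suff : (rearr mu f 1 <= rearr mu h1 1 + N2)%R by rewrite /=; lra.
apply/ler_addgt0Pr => e e0; have e20 : (0 < e / 2)%R by rewrite divr_gt0.
rewrite -lee_fin (rearrE muT p1 fp)//.
apply: rearrangement_le; first by rewrite !addr_ge0 ?rearr_ge0// ltW.
have m1 := Lfun_measurable h1p; have m2 := Lfun_measurable h2p.
pose F1 := [set x | (rearr mu h1 1 + e / 2 < `|h1 x|)%R].
pose F2 := [set x | (N2 + e / 2 < `|h2 x|)%R].
have mF1 : measurable F1 by exact: measurable_superlevel.
have mF2 : measurable F2 by exact: measurable_superlevel.
apply: (@le_trans _ _ (mu (F1 `|` F2))).
  apply: le_measure; rewrite ?inE.
  - exact/measurable_superlevel/(Lfun_measurable fp).
  - exact: measurableU.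
  move=> x /= fx; apply: contrapT => /not_orP[/= /negP F1x /negP F2x].
  move: F1x F2x; rewrite -!leNgt => F1x F2x.
  by have := ler_normD (h1 x) (h2 x); rewrite -fh; lra.
have FF : mu (F1 `|` F2) <= mu F1 + mu F2 by exact: measureU2.
apply: (le_trans FF); rewrite -[leRHS]adde0 leeD//.
  by apply: rearrangement_lt => //; rewrite -(rearrE muT (lexx 1) h1p)// lte_fin ltrDl.
by apply: rearrangement_lt => //; rewrite (le_lt_trans h20)// lte_fin ltrDl.
Qed.

(** For finite [p] the bound has to include [p = 1], where [t^-1] is not
    integrable and the weak-type bound is not enough.  Instead [x <= l + l^(1-p) x^p]
    is applied to the values of the rearrangement with [l = M / t^(1/p)], and
    the powers are summed by [sum_rearr_powR_le_Lnorm]. *)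
Lemma max_rearrangement_weak_type p : 1 <= p ->
  exists2 C : R, (0 < C)%R & forall (g : T -> R) t, g \in Lfun mu p -> (0 < t)%R ->
    max_rearrangement mu g t <= (C * fine 'N[mu]_p[EFin \o g] / t `^ fine p^-1)%:E.
Proof.
move=> p1; case: p p1 => [p||]// p1; last first.
  exists 4%R => // g t gp t0; rewrite invey/= powRr0 divr1.
  apply: (max_rearrangement_le_dyadic muT p1 gp t0) => m.
  set M := fine _; have M0 : (0 <= M)%R by exact/fine_ge0/Lnorm_ge0.
  apply: (@le_trans _ _ (\sum_(i < m) 2 * M * (2^-1) ^+ i))%R.
    apply: ler_sum => i _; rewrite ler_pdivrMr ?exprn_gt0//.
    have ti : (0 < t / 2 ^+ i.+1)%R by rewrite divr_gt0// exprn_gt0.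
    have := rearr_weak_type muT p1 gp ti; rewrite invey/= powRr0 mul1r => /le_trans; apply.
    rewrite exprS exprVn -/M le_eqVlt; apply/orP; left; apply/eqP.
    by field; rewrite expf_neq0.
  rewrite -mulr_sumr (_ : 4 * M = 2 * M * (1 - 2^-1)^-1)%R; last by field.
  by rewrite ler_wpM2l ?mulr_ge0// sum_geometric_lt//; lra.
rewrite lee_fin in p1; have p0 : (0 < p)%R by rewrite (lt_le_trans _ p1).
have p1' : 1 <= p%:E by rewrite lee_fin.
exists (1 + 2 * 2 `^ p)%R; first by rewrite addr_gt0// mulr_gt0// powR_gt0.
move=> g t gp t0; rewrite inver gt_eqF//=.
set M := fine _; have M0 : (0 <= M)%R by exact/fine_ge0/Lnorm_ge0.
apply: (max_rearrangement_le_dyadic muT p1' gp t0) => m.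
have ti (i : nat) : (0 < t / 2 ^+ i.+1)%R by rewrite divr_gt0// exprn_gt0.
have [M00|Mgt0] := leP M 0%R.
  have M00' : M = 0%R by apply/eqP; rewrite eq_le M00.
  rewrite big1.
    by rewrite mulr_ge0 ?invr_ge0 ?powR_ge0// mulr_ge0// addr_ge0// mulr_ge0// powR_ge0.
  move=> i _; have := rearr_weak_type muT p1' gp (ti i); rewrite inver gt_eqF//= -/M M00' mulr0.
  rewrite pmulr_rle0 ?powR_gt0// => g0.
  by rewrite (_ : rearr _ _ _ = 0)%R ?mul0r//; apply/eqP; rewrite eq_le g0 rearr_ge0.
pose l := (M / t `^ p^-1)%R.
have l0 : (0 < l)%R by rewrite divr_gt0// powR_gt0.
have pw (x : R) : (0 <= x)%R -> (x <= l + l `^ (1 - p) * x `^ p)%R.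
  move=> x0; have [xl|lx] := leP x l.
    by rewrite (le_trans xl)// lerDl mulr_ge0 ?powR_ge0.
  have -> : (1 - p = - (p - 1))%R by ring.
  rewrite powRN; apply: (@le_trans _ _ ((l `^ (p - 1))^-1 * x `^ p)%R); last first.
    by rewrite lerDr ltW.
  rewrite mulrC ler_pdivlMr ?powR_gt0// -(mulr_powRB1 x0 p0) ler_wpM2l//.
  by apply: ge0_ler_powR; rewrite ?nnegrE ?subr_ge0// ltW.
have lay := sum_rearr_powR_le_Lnorm m.+1 muT p1 gp t0.
have lE : (l `^ (1 - p) * (2 * 2 `^ p * M `^ p) / t = 2 * 2 `^ p * l)%R.
  have -> : M = (l * t `^ p^-1)%R by rewrite /l divfK// gt_eqF// powR_gt0.
  rewrite (@powRM _ l (t `^ p^-1)%R) ?powR_ge0 ?(ltW l0)//.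
  rewrite -(powRrM t) mulVf ?gt_eqF// powRr1 ?(ltW t0)//.
  have lp : (l `^ (1 - p) * l `^ p = l)%R.
    by rewrite -powRD ?subrK ?powRr1 ?(ltW l0)// (gt_eqF l0) implybT.
  rewrite -[in RHS]lp.
  by field; rewrite gt_eqF.
have half m' : (\sum_(i < m') (2^-1 : R) ^+ i.+1 <= 1)%R.
  have h : (0 <= (2^-1 : R) < 1)%R by lra.
  rewrite (eq_bigr (fun i : 'I_m' => 2^-1 * 2^-1 ^+ i)%R); last by move=> i _; rewrite exprS.
  rewrite -mulr_sumr; have := sum_geometric_lt m' h.
  by rewrite (_ : (1 - 2^-1)^-1 = 2)%R; [lra|field].
apply: (@le_trans _ _ (l + l `^ (1 - p) / t *
    \sum_(i < m) t / 2 ^+ i.+1 * rearr mu g (t / 2 ^+ i.+1) `^ p))%R.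
  apply: (@le_trans _ _ (\sum_(i < m) (l * 2^-1 ^+ i.+1 +
      l `^ (1 - p) / t * (t / 2 ^+ i.+1 * rearr mu g (t / 2 ^+ i.+1) `^ p))))%R.
    apply: ler_sum => i _; rewrite ler_pdivrMr ?exprn_gt0//.
    apply: (le_trans (pw _ (rearr_ge0 _ _ _))).
    rewrite exprVn le_eqVlt; apply/orP; left; apply/eqP.
    by field; rewrite (gt_eqF t0) expf_neq0.
  rewrite big_split/= -!mulr_sumr lerD2r.
  rewrite -[leRHS]mulr1 ler_wpM2l ?(ltW l0)//.
  exact: half.
rewrite [leRHS](_ : _ = l + 2 * 2 `^ p * l)%R; last by rewrite /l; ring.
rewrite lerD2l -lE mulrAC ler_wpM2r ?invr_ge0 ?(ltW t0)// ler_wpM2l ?powR_ge0//.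
apply: le_trans lay; rewrite big_ord_recl/= lerDr mulr_ge0 ?powR_ge0//.
by rewrite divr_ge0// ltW.
Qed.

(** Integrate the oscillation inequality over [z] in [(0, t)]. *)
Lemma max_rearrangement_gap p (K : R) : 1 <= p -> (0 <= K)%R ->
  exists2 C : R, (0 < C)%R & forall (f g : T -> R) (t : R),
    f \in Lfun mu p -> g \in Lfun mu p -> oscillation_bound mu 1 K f g ->
    (0 < t)%R ->
    (t `^ fine p^-1)%:E *
      ((max_rearrangement mu f t - rearrangement mu f t) * (t^-1)%:E)
    <= C%:E * 'N[mu]_p[EFin \o g].
Proof.
move=> p1 K0; have [C C0 hC] := max_rearrangement_weak_type p1.
exists (K * (4 + C) + 1)%R; first by rewrite ltr_wpDl// mulr_ge0// addr_ge0// ltW.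
move=> f g t fp gp osc t0.
rewrite -['N[mu]_p[_]]fineK ?Lfun_Lnorm_fin//.
set M := fine 'N[mu]_p[EFin \o g].
have M0 : (0 <= M)%R by exact/fine_ge0/Lnorm_ge0.
set u := fine p^-1; have tu0 : (0 < t `^ u)%R by exact: powR_gt0.
set a := rearr mu f t; set b := rearr mu g t.
have a0 : (0 <= a)%R by exact: rearr_ge0.
have b0 : (0 <= b)%R by exact: rearr_ge0.
have hb : (t `^ u * b <= 4 * M)%R by exact: rearr_weak_type.
have hF : max_rearrangement mu f t <=
    (a + K * t * b)%:E + (K * t)%:E * max_rearrangement mu g t.
  have Kt0 : (0 <= K * t)%R by rewrite mulr_ge0// ltW.
  have A0 : (0 <= a + K * t * b)%R by rewrite addr_ge0// mulr_ge0.
  rewrite -(@lee_pmul2l _ t%:E)// -max_rearrangementE//.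
  rewrite ge0_muleDr ?lee_fin//; last first.
    by rewrite mule_ge0 ?lee_fin// max_rearrangement_ge0// ltW.
  rewrite muleCA -max_rearrangementE//.
  apply: (@le_trans _ _ (\int[leb]_(z in `]0%R, t[)
      ((a + K * t * b)%:E + (K * t)%:E * rearrangement mu g z))).
    apply: ge0_le_integral => //=.
    - by move=> z _; exact: rearrangement_ge0.
    - exact: measurable_rearrangement.
    - apply: emeasurable_funD => //; apply: measurable_funeM.
      exact: measurable_rearrangement.
    move=> z; rewrite in_itv/= => /andP[z0 _].
    rewrite -(rearrE muT p1 fp)// -(rearrE muT p1 gp)// -EFinM -EFinD lee_fin.
    by have := osc z t z0 t0; rewrite powRr1 ?(ltW t0)// -/a -/b; lra.
  rewrite ge0_integralD//=; last 2 first.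
  - by move=> z _; apply: mule_ge0; [rewrite lee_fin|exact: rearrangement_ge0].
  - by apply: measurable_funeM; exact: measurable_rearrangement.
  rewrite ge0_integralZl_EFin//; last 2 first.
  - by move=> z _; exact: rearrangement_ge0.
  - exact: measurable_rearrangement.
  rewrite integral_cst//= lebesgue_measure_itv/= lte_fin t0 -EFinB subr0 leeD2r//.
  by rewrite muleC.
rewrite -(rearrE muT p1 fp)// -/a.
have {}hF : max_rearrangement mu f t - a%:E <= (K * t * (b + C * M / t `^ u))%:E.
  rewrite leeBlDr//; apply: (le_trans hF).
  apply: (@le_trans _ _ ((a + K * t * b)%:E + (K * t)%:E * (C * M / t `^ u)%:E)).
    by rewrite leeD2l// lee_wpmul2l ?lee_fin ?mulr_ge0 ?(ltW t0)//; exact: hC.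
  by rewrite -EFinM -!EFinD lee_fin; lra.
apply: (@le_trans _ _ ((t `^ u)%:E * ((K * t * (b + C * M / t `^ u))%:E * (t^-1)%:E))).
  rewrite lee_wpmul2l ?lee_fin ?(ltW tu0)// lee_wpmul2r ?lee_fin ?invr_ge0 ?(ltW t0)//.
rewrite -!EFinM lee_fin.
have -> : (t `^ u * (K * t * (b + C * M / t `^ u) / t) = K * (t `^ u * b + C * M))%R.
  by field; rewrite !gt_eqF.
rewrite mulrDl mul1r; apply: (@le_trans _ _ (K * (4 + C) * M)%R); last by rewrite lerDl.
by rewrite -mulrA ler_wpM2l// mulrDl lerD2r.
Qed.

End SupercriticalAndWeak.

(** * The embedding theorem *)

Local Open Scope ereal_scope.

Lemma fine_inve_le1 (R : realType) (p : \bar R) : 1 <= p ->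
  p^-1 \is a fin_num /\ (fine p^-1 <= 1)%R.
Proof.
case: p => [p||]//; rewrite lee_fin => p1.
 have p0 : (0 < p)%R by rewrite (lt_le_trans _ p1).
by rewrite inver gt_eqF//= invf_le1.
Qed.

Theorem corollary8 (R : realType) (d : measure_display)
    (Omega : metricMeasurableType R d) (mu : {measure set Omega -> \bar R})
    (c alpha s : R) (p : \bar R)
    (hOmega : metric_measure_space mu)
    (hc : (1 <= c)%R) (hmuc : almost_continuous mu c)
    (halpha : (0 < alpha)%R) (hmualpha : lower_bounded mu alpha)
    (hs : (0 < s)%R) (hp : 1 <= p) :
  exists2 C : R, (0 < C)%R &
  forall f : Omega -> R, hajlasz_sobolev mu s p f ->
  forall g : Omega -> R, sgradient mu s p f g ->
  [/\ (s / alpha < 1)%R ->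
      [/\ (s / alpha)%:E < p^-1 ->
            lorentz_norm mu
              (alpha * fine p / (alpha - s * fine p))%R (fine p) f
            <= C%:E * 'N[mu]_p[EFin \o g],
          p^-1 = (s / alpha)%:E ->
            (\int[lebesgue_measure]_(t in `]0%R, 1%R[)
               ((max_rearrangement mu f t * ((1 + ln (t^-1))^-1)%:E)
                  `^ fine p * (t^-1)%:E)) `^ (fine p)^-1
            <= C%:E * ('N[mu]_p[EFin \o g] + sum_L1_Linfty_norm mu f)
        & p^-1 < (s / alpha)%:E ->
            'N[mu]_+oo[EFin \o f]
            <= C%:E * ('N[mu]_p[EFin \o g] + sum_L1_Linfty_norm mu f)],
      (s / alpha)%R = 1%R ->
        ereal_sup [set (t `^ fine p^-1)%:E *
            ((max_rearrangement mu f t - rearrangement mu f t) * (t^-1)%:E)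
          | t in `]0%R, +oo[ ]
        <= C%:E * 'N[mu]_p[EFin \o g]
        /\ (p = 1 -> weak_Linfty mu f <= C%:E * hajlasz_norm mu s p f)
    & (1 < s / alpha)%R ->
        'N[mu]_+oo[EFin \o f]
        <= C%:E * ('N[mu]_p[EFin \o g] + sum_L1_Linfty_norm mu f)].

Proof.
pose sg := (s / alpha)%R; pose K := ((3 * c) `^ sg)%R.
have K0 : (0 <= K)%R by exact: powR_ge0.
have sg0 : (0 < sg)%R by rewrite divr_gt0.
have muT : 0 < mu setT by have [_ _ -> _] := hOmega; rewrite ltry.
have [pVfin pV1] := fine_inve_le1 hp.
have pcase : (exists2 q : R, (1 <= q)%R & p = q%:E) \/ p = +oo.
  by move: hp; case E : p => [q||]//; rewrite ?lee_fin => q1; [left; exists q|right].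
(* The case distinction does not involve [f] and [g], so a constant is found for
   each case separately and the constants are added. *)
have lift (P : Prop) (Q : R -> Prop) : (P -> exists2 C : R, (0 < C)%R & Q C) ->
    exists2 C : R, (0 < C)%R & (P -> Q C).
  by move=> PQ; have [/PQ[C C0 QC]|nP] := pselect P; [exists C | exists 1%R].
pose good (H : (Omega -> R) -> (Omega -> R) -> Prop) := forall f g : Omega -> R,
  f \in Lfun mu p -> g \in Lfun mu p -> oscillation_bound mu sg K f g -> H f g.
have [C1 C10 h1] : exists2 C : R, (0 < C)%R & (sg%:E < p^-1 -> good (fun f g =>
    lorentz_norm mu (alpha * fine p / (alpha - s * fine p))%R (fine p) f
      <= C%:E * 'N[mu]_p[EFin \o g])).
  apply: lift; rewrite /good; case: pcase => [[q q1 ->]|->]; last first.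
    by rewrite invey lte_fin ltNge (ltW sg0).
  have q0 : (0 < q)%R by rewrite (lt_le_trans _ q1).
  rewrite inver gt_eqF// lte_fin => sq.
  apply: lorentz_subcritical => //=.
  rewrite invf_div /sg; field.
  by rewrite !gt_eqF.
have [C2 C20 h2] : exists2 C : R, (0 < C)%R &
    ((sg < 1)%R /\ p^-1 = sg%:E -> good (fun f g =>
    (\int[lebesgue_measure]_(t in `]0%R, 1%R[)
       ((max_rearrangement mu f t * ((1 + ln (t^-1))^-1)%:E)
          `^ fine p * (t^-1)%:E)) `^ (fine p)^-1
    <= C%:E * ('N[mu]_p[EFin \o g] + (rearr mu f 1)%:E))).
  apply: lift; rewrite /good; case: pcase => [[q q1 ->]|->]; last first.
    by rewrite invey => -[_ [sgE]]; move: sg0; rewrite -sgE ltxx.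
  have q0 : (0 < q)%R by rewrite (lt_le_trans _ q1).
  rewrite inver gt_eqF// => -[sg1 [sgE]].
  rewrite -sgE; apply: log_critical => //.
  by rewrite -invf_lt1// sgE.
have [C3 C30 h3] : exists2 C : R, (0 < C)%R & ((fine p^-1 < sg)%R -> good (fun f g =>
    'N[mu]_+oo[EFin \o f] <= C%:E * ('N[mu]_p[EFin \o g] + (rearr mu f 1)%:E))).
  by apply: lift => psg; exact: Linfty_supercritical.
have [C4 C40 h4] : exists2 C : R, (0 < C)%R & (sg = 1%R -> good (fun f g =>
    forall t : R, (0 < t)%R -> (t `^ fine p^-1)%:E *
      ((max_rearrangement mu f t - rearrangement mu f t) * (t^-1)%:E)
    <= C%:E * 'N[mu]_p[EFin \o g])).
  apply: lift => sg1; rewrite /good sg1.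
  have [C C0 hC] := max_rearrangement_gap muT hp K0.
  by exists C => // f g fp gp osc t t0; exact: hC.
(* The factors 4 come from [rearr1_le_sum_norm]. *)
pose C := (C1 + 4 * C2 + 4 * C3 + C4)%R.
have C0 : (0 < C)%R by rewrite !addr_gt0// mulr_gt0.
exists C => // f [fp _] g gs.
have osc g' : sgradient mu s p f g' -> oscillation_bound mu sg K f g'.
  exact: (oscillation_estimate hOmega hc hmuc halpha hmualpha hs hp fp).
have gp : g \in Lfun mu p by case: gs.
have N0 : 0 <= 'N[mu]_p[EFin \o g] by exact: Lnorm_ge0.
have S0 : 0 <= sum_L1_Linfty_norm mu f.
  by apply: le_ereal_inf_tmp => _ [h _ <-]; rewrite adde_ge0 ?Lnorm_ge0.
have toC (D : R) (x : \bar R) : (0 <= D <= C)%R -> 0 <= x -> D%:E * x <= C%:E * x.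
  by move=> /andP[D0 DC] x0; rewrite lee_wpmul2r.
have toS (D : R) : (0 <= D)%R -> (4 * D <= C)%R ->
    D%:E * ('N[mu]_p[EFin \o g] + (rearr mu f 1)%:E) <=
    C%:E * ('N[mu]_p[EFin \o g] + sum_L1_Linfty_norm mu f).
  move=> D0 DC; apply: (@le_trans _ _
    ((4 * D)%:E * ('N[mu]_p[EFin \o g] + sum_L1_Linfty_norm mu f))).
    rewrite mulrC EFinM -muleA lee_wpmul2l ?lee_fin//.
    rewrite ge0_muleDr//; apply: leeD; last exact: rearr1_le_sum_norm fp.
    by rewrite -[leLHS]mul1e lee_wpmul2r// lee_fin ler1n.
  by rewrite lee_wpmul2r ?lee_fin// adde_ge0.
have C1C : (0 <= C1 <= C)%R by rewrite /C (ltW C10); lra.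
have C4C : (0 <= C4 <= C)%R by rewrite /C (ltW C40); lra.
have C2C : (4 * C2 <= C)%R by rewrite /C; lra.
have C3C : (4 * C3 <= C)%R by rewrite /C; lra.
split.
- move=> sg1; split.
  + move=> psg; apply: le_trans (toC _ _ C1C N0); apply: h1 => //; exact: osc.
  + move=> psg; apply: le_trans (toS _ (ltW C20) C2C); apply: h2 => //; exact: osc.
  + move=> psg; apply: le_trans (toS _ (ltW C30) C3C); apply: h3 => //; last exact: osc.
    by rewrite -lte_fin fineK.
- move=> sg1.
  have key g' : sgradient mu s p f g' -> forall t : R, (0 < t)%R ->
      (t `^ fine p^-1)%:E *
        ((max_rearrangement mu f t - rearrangement mu f t) * (t^-1)%:E)
      <= C%:E * 'N[mu]_p[EFin \o g'].
    move=> gs' t t0; have gp' : g' \in Lfun mu p by case: gs'.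
    apply: le_trans (toC _ _ C4C (Lnorm_ge0 _ _ _)).
    by apply: h4 => //; exact: osc.
  split.
    apply: ge_ereal_sup => x [t /=]; rewrite in_itv/= andbT => t0 <-{x}.
    exact: key.
  move=> pE; apply: ge_ereal_sup => x [t /=]; rewrite in_itv/= andbT => t0 <-{x}.
  have key1 g' : sgradient mu s p f g' ->
      (max_rearrangement mu f t - rearrangement mu f t) <= C%:E * 'N[mu]_p[EFin \o g'].
    move=> gs'; have := key g' gs' t t0.
    rewrite pE inve1/= powRr1 ?(ltW t0)// muleCA -EFinM divff ?gt_eqF// mule1.
    by rewrite -pE.
  rewrite /hajlasz_norm; set I := ereal_inf _.
  apply: (@le_trans _ _ (C%:E * I)); last first.
    by rewrite lee_wpmul2l ?lee_fin ?(ltW C0)// leeDr// Lnorm_ge0.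
  rewrite -lee_pdivrMl//; apply: le_ereal_inf_tmp => _ [g' gs' <-].
  by rewrite lee_pdivrMl//; exact: key1.
- move=> sg1; apply: le_trans (toS _ (ltW C30) C3C); apply: h3 => //; last exact: osc.
  exact: le_lt_trans sg1.
Qed.
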